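(* Let $R$ be a $\mathbb{Z}$-graded ring which is right artinian, and let $N$ be a finitely generated right $R$-module. The following are equivalent: (i) $N$ is gradable; (ii) the pull-up $pN$ is pure-projective; (iii) $qpN\cong N^{(\omega)}$ as right $R$-modules, where $N^{(\omega)}$ is the direct sum of countably infinitely many copies of $N$.
   Context: ''Graded'' means $\mathbb{Z}$-graded. A graded right $R$-module is $M=\bigoplus_{n\in\mathbb{Z}}M_n$ with $M_iR_j\subseteq M_{i+j}$. The functor $q$ sends a graded right $R$-module to its underlying (ungraded) right $R$-module. A right $R$-module is gradable if it is isomorphic to $qM$ for some graded module $M$. For any right $R$-module $N$, the pull-up $pN$ is the graded right $R$-module $pN=\bigoplus_{n\in\mathbb{Z}}Ne_n$ with degree-$n$ component $(pN)_n=Ne_n$ a copy of $N$ (the $e_n$ are formal symbols), and action $(xe_n)r=(xr)e_{n+j}$ for $x\in N$, $r\in R_j$, extended linearly. A module is pure-projective if it is isomorphic to a direct summand of a direct sum of finitely presented modules. *)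

(* Defs.v *)
From HB Require Import structures.
From mathcomp Require Import all_boot all_order all_algebra finmap.
From mathcomp Require Import boolp classical_sets functions cardinality fsbigop.

Set Implicit Arguments.
Unset Strict Implicit.
Unset Printing Implicit Defensive.

Import GRing.Theory.
Local Open Scope classical_set_scope.
Local Open Scope ring_scope.

(** A right R-module is a left module over the converse ring R^c: an object of
    [lmodType R^c].  [ract x r] is the right action, usually written x r. *)

Definition ract (R : pzRingType) (M : lmodType R^c) (x : M) (r : R) : M :=
  (r : R^c) *: x.

Definition mod_iso (R : pzRingType) (M N : lmodType R^c) : Prop :=
  exists f : {linear M -> N}, bijective f.

Definition right_ideal (R : pzRingType) (I : set R) : Prop :=
  [/\ I 0, forall x y, I x -> I y -> I (x - y)
    & forall x r, I x -> I (x * r)].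

Definition right_artinian (R : pzRingType) : Prop :=
  forall I : nat -> set R,
    (forall n, right_ideal (I n)) -> (forall n, I n.+1 `<=` I n) ->
    exists n, forall m, (n <= m)%N -> I m = I n.

Definition finitely_generated (R : pzRingType) (M : lmodType R^c) : Prop :=
  exists (n : nat) (x : 'I_n -> M),
    forall y : M, exists a : 'I_n -> R, y = \sum_(i < n) ract (x i) (a i).

(** ['rV[R^c]_n] is the free right R-module of rank n, so this is the existence
    of an exact sequence R^k -> R^n -> M -> 0. *)
Definition finitely_presented (R : pzRingType) (M : lmodType R^c) : Prop :=
  exists (k n : nat) (f : {linear 'rV[R^c]_k -> 'rV[R^c]_n})
         (g : {linear 'rV[R^c]_n -> M}),
    range g = [set: M] /\ range f = g @^-1` [set 0].

(** The external direct sum of F: families of finite support. *)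

Record dsum (I : Type) (F : I -> zmodType) : Type := DSum {
  dsum_val :> forall i, F i;
  dsum_fin : finite_set [set i | dsum_val i <> 0]
}.

HB.instance Definition _ I (F : I -> zmodType) := gen_eqMixin (dsum F).
HB.instance Definition _ I (F : I -> zmodType) := gen_choiceMixin (dsum F).

Section DsumZmod.
Variables (I : Type) (F : I -> zmodType).
Implicit Types x y z : dsum F.

Lemma dsumP x y : (forall i, x i = y i) -> x = y.
Proof.
case: x y => [x hx] [y hy] /= xy.
have e : x = y by apply: functional_extensionality_dep.
by case: _ / e hy => hy; congr DSum; apply: Prop_irrelevance.
Qed.

Lemma dsum0_fin : finite_set [set i : I | (0 : F i) <> 0].
Proof. by rewrite (_ : mkset _ = set0) // -subset0 => i /=. Qed.
Definition dsum0 := DSum dsum0_fin.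

Lemma dsumN_fin x : finite_set [set i | - x i <> 0].
Proof.
apply: sub_finite_set (dsum_fin x) => i /= h e.
by apply: h; rewrite e oppr0.
Qed.
Definition dsumN x := DSum (dsumN_fin x).

Lemma dsumD_fin x y : finite_set [set i | x i + y i <> 0].
Proof.
apply: (@sub_finite_set _ _ ([set i | x i <> 0] `|` [set i | y i <> 0])).
  move=> i /= h; have [x0|] := pselect (x i = 0); last by left.
  by right=> y0; apply: h; rewrite x0 y0 addr0.
by rewrite finite_setU; split; apply: dsum_fin.
Qed.
Definition dsumD x y := DSum (dsumD_fin x y).

Lemma dsumDA : associative dsumD.
Proof. by move=> x y z; apply: dsumP => i /=; rewrite addrA. Qed.
Lemma dsumDC : commutative dsumD.
Proof. by move=> x y; apply: dsumP => i /=; rewrite addrC. Qed.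
Lemma dsumD0 : left_id dsum0 dsumD.
Proof. by move=> x; apply: dsumP => i /=; rewrite add0r. Qed.
Lemma dsumDN : left_inverse dsum0 dsumN dsumD.
Proof. by move=> x; apply: dsumP => i /=; rewrite addNr. Qed.

HB.instance Definition _ :=
  GRing.isZmodule.Build (dsum F) dsumDA dsumDC dsumD0 dsumDN.

Lemma dsum0E i : (0 : dsum F) i = 0. Proof. by []. Qed.
Lemma dsumDE x y i : (x + y) i = x i + y i. Proof. by []. Qed.
Lemma dsumNE x i : (- x) i = - x i. Proof. by []. Qed.

End DsumZmod.

Section DsumLmod.
Variables (K : pzRingType) (I : Type) (F : I -> lmodType K).
Implicit Types x y : dsum F.

Lemma dsumZ_fin (a : K) x : finite_set [set i | a *: x i <> 0].
Proof.
apply: sub_finite_set (dsum_fin x) => i /= h e.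
by apply: h; rewrite e scaler0.
Qed.
Definition dsumZ a x : dsum F := DSum (dsumZ_fin a x).

Lemma dsumZA a b x : dsumZ a (dsumZ b x) = dsumZ (a * b) x.
Proof. by apply: dsumP => i /=; rewrite scalerA. Qed.
Lemma dsumZ1 : left_id 1 dsumZ.
Proof. by move=> x; apply: dsumP => i /=; rewrite scale1r. Qed.
Lemma dsumZDr : right_distributive dsumZ +%R.
Proof. by move=> a x y; apply: dsumP => i /=; rewrite scalerDr. Qed.
Lemma dsumZDl x : {morph dsumZ^~ x : a b / a + b}.
Proof. by move=> a b; apply: dsumP => i /=; rewrite scalerDl. Qed.

HB.instance Definition _ :=
  GRing.Zmodule_isLmodule.Build K (dsum F) dsumZA dsumZ1 dsumZDr dsumZDl.

Definition direct_sum : lmodType K := dsum F.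
End DsumLmod.

Definition countable_copower (K : pzRingType) (N : lmodType K) : lmodType K :=
  direct_sum (fun _ : nat => N).

(** [is_grading G]: V is the internal direct sum of the subgroups G n.  Since
    [\sum_(n \in _)] is 0 on families of infinite support, the finiteness of
    the support has to be stated. *)
Definition is_grading (V : zmodType) (G : int -> set V) : Prop :=
  (forall n, G n 0 /\ forall x y, G n x -> G n y -> G n (x - y)) /\
  forall x : V, exists! f : int -> V,
    [/\ finite_set [set n | f n <> 0], forall n, G n (f n)
      & x = \sum_(n \in [set: int]) f n].

Record gradedRing : Type := GradedRing {
  gr_ring :> pzRingType;
  gr_comp : int -> set gr_ring;
  gr_grading : is_grading gr_comp;
  gr_mul : forall i j r s,
    gr_comp i r -> gr_comp j s -> gr_comp (i + j) (r * s)
}.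

(** [forget] is the functor q. *)
Record gradedMod (R : gradedRing) : Type := GradedMod {
  forget : lmodType R^c;
  gm_comp : int -> set forget;
  gm_grading : is_grading gm_comp;
  gm_act : forall i j x r,
    gm_comp i x -> gr_comp j r -> gm_comp (i + j) (ract x r)
}.

Definition gradable (R : gradedRing) (N : lmodType R^c) : Prop :=
  exists M : gradedMod R, mod_iso N (forget M).

Definition graded_iso (R : gradedRing) (M N : gradedMod R) : Prop :=
  exists f : {linear forget M -> forget N},
    bijective f /\ forall n x, gm_comp n x -> gm_comp n (f x).

Section GradingTheory.
Variables (V : zmodType).
Implicit Types f g : int -> V.

Lemma fsumE f (A : seq int) : uniq A -> (forall n, n \notin A -> f n = 0) ->
  \sum_(n \in [set: int]) f n = \sum_(n <- A) f n.
Proof.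
move=> uA hA; rewrite (fsbigTE [fset n in A]%fset); last first.
  by move=> n; rewrite !inE => /hA.
apply: perm_big; apply: uniq_perm => //.
by move=> n; rewrite !inE.
Qed.

Lemma finsupp2 f g : finite_set [set n | f n <> 0] ->
  finite_set [set n | g n <> 0] ->
  exists2 A : seq int, uniq A &
    (forall n, n \notin A -> f n = 0) /\ (forall n, n \notin A -> g n = 0).
Proof.
move=> /finite_seqP[s hs] /finite_seqP[t ht].
exists (undup (s ++ t)); first exact: undup_uniq.
split=> n; rewrite mem_undup mem_cat negb_or => /andP[/negP ns /negP nt].
  by apply: contrapT => h; apply: ns; have : [set` s] n by rewrite -hs.
by apply: contrapT => h; apply: nt; have : [set` t] n by rewrite -ht.
Qed.

Lemma finsupp1 f : finite_set [set n | f n <> 0] ->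
  exists2 A : seq int, uniq A & (forall n, n \notin A -> f n = 0).
Proof. by move=> h; have [A uA [hA _]] := finsupp2 h h; exists A. Qed.

Lemma finsuppP f (A : seq int) : (forall n, n \notin A -> f n = 0) ->
  finite_set [set n | f n <> 0].
Proof.
move=> h; apply: (@sub_finite_set _ _ [set` A]); last exact: finite_seq.
by move=> n /= hn; apply/negPn/negP => /h.
Qed.

Variables (G : int -> set V) (hG : is_grading G).

Lemma gradN n x : G n x -> G n (- x).
Proof. by have [G0 GB] := hG.1 n => Gx; rewrite -sub0r; apply: GB. Qed.

Lemma gradD n x y : G n x -> G n y -> G n (x + y).
Proof.
have [G0 GB] := hG.1 n => Gx Gy; rewrite -[y]opprK; apply: GB => //.
exact: gradN.
Qed.

(** [hcomp x n] is the homogeneous component of degree n of x. *)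
Definition hcomp (x : V) : int -> V := projT1 (cid (hG.2 x)).

Lemma hcompP x : [/\ finite_set [set n | hcomp x n <> 0],
  forall n, G n (hcomp x n) & x = \sum_(n \in [set: int]) hcomp x n].
Proof. by rewrite /hcomp; case: cid => f /= []. Qed.

Lemma hcomp_uniq x f : finite_set [set n | f n <> 0] ->
  (forall n, G n (f n)) -> x = \sum_(n \in [set: int]) f n -> hcomp x = f.
Proof. by move=> h1 h2 h3; rewrite /hcomp; case: cid => g /= [_]; apply. Qed.

Lemma hcomp_hom n x : G n x ->
  hcomp x = fun m => if m == n then x else 0.
Proof.
move=> Gx; have h m : m \notin [:: n] -> (if m == n then x else 0) = 0.
  by rewrite inE => /negbTE ->.
apply: hcomp_uniq; first exact: finsuppP h.
  by move=> m; case: eqP => [->//|_]; case: (hG.1 m).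
by rewrite (fsumE _ h)// big_seq1 eqxx.
Qed.

Lemma hcompD x y : hcomp (x + y) = fun n => hcomp x n + hcomp y n.
Proof.
have [fx Gx ex] := hcompP x; have [fy Gy ey] := hcompP y.
have [A uA [hx hy]] := finsupp2 fx fy.
have h n : n \notin A -> hcomp x n + hcomp y n = 0.
  by move=> nA; rewrite hx// hy// addr0.
apply: hcomp_uniq; first exact: finsuppP h.
  by move=> n; apply: gradD.
by rewrite (fsumE uA h) big_split/= {1}ex {1}ey !(@fsumE _ A).
Qed.

Lemma grading_ind (P : V -> Prop) : P 0 ->
  (forall x y, P x -> P y -> P (x + y)) ->
  (forall n x, G n x -> P x) -> forall x, P x.
Proof.
move=> P0 PD PG x; have [fx Gx ->] := hcompP x.
have [A uA h] := finsupp1 fx; rewrite (fsumE uA h).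
by elim/big_ind: _ => // n _; apply: PG (Gx n).
Qed.

End GradingTheory.

Lemma hcomp1 (R : gradedRing) :
  hcomp (gr_grading R) 1 = fun n => if n == 0 then 1 else 0.
Proof.
set e := hcomp _ _; have [fe Ge ee] := hcompP (gr_grading R) 1.
rewrite -/e in fe Ge ee.
suff e0 : forall x : R, e 0 * x = x.
  by apply: hcomp_hom; rewrite -(e0 1) mulr1; apply: Ge.
apply: (grading_ind (gr_grading R)); first by rewrite mulr0.
  by move=> x y ex ey; rewrite mulrDr ex ey.
move=> n x Gx; have [A uA hA] := finsupp1 fe.
have h m : m \notin [seq i + n | i <- A] -> e (m - n) * x = 0.
  move=> hm; rewrite hA ?mul0r//; apply: contra hm => hm.
  by apply/mapP; exists (m - n) => //; rewrite subrK.
have : hcomp (gr_grading R) x = fun m => e (m - n) * x.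
  apply: hcomp_uniq; first exact: finsuppP h.
    by move=> m; rewrite -{1}(subrK n m); apply: gr_mul.
  rewrite (fsumE _ h) ?map_inj_uniq//; last exact: addIr.
  rewrite big_map -[LHS]mul1r ee (fsumE uA hA) mulr_suml.
  by apply: eq_bigr => i _; rewrite addrK.
rewrite (hcomp_hom (gr_grading R) Gx) => /(congr1 (fun f => f n)) /=.
by rewrite eqxx subrr => <-.
Qed.

Lemma dsum_sumE (I : Type) (F : I -> zmodType) (J : Type) (A : seq J)
    (f : J -> dsum F) i : (\sum_(n <- A) f n) i = \sum_(n <- A) f n i.
Proof. exact: (big_morph (fun x : dsum F => x i)). Qed.

(** A family x of finite support stands for the formal sum of the (x n) e_n. *)

Definition pullup_carrier (R : gradedRing) (N : lmodType R^c) : Type :=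
  dsum (fun _ : int => N : zmodType).

Section Pullup.
Variables (R : gradedRing) (N : lmodType R^c).
Local Notation P := (pullup_carrier N).
Local Notation "r `_[ j ]" := (hcomp (gr_grading R) r j) (at level 3).

HB.instance Definition _ := GRing.Zmodule.copy P (dsum (fun _ : int => N : zmodType)).

Implicit Types (x y : P) (r s : R).

Lemma ract0 (u : N) : ract u (0 : R) = 0. Proof. exact: scale0r. Qed.
Lemma ract0l r : ract (0 : N) r = 0. Proof. exact: scaler0. Qed.
Lemma ractD (u : N) r s : ract u (r + s) = ract u r + ract u s.
Proof. exact: scalerDl. Qed.
Lemma ractDl (u v : N) r : ract (u + v) r = ract u r + ract v r.
Proof. exact: scalerDr. Qed.
Lemma ractM (u : N) r s : ract (ract u r) s = ract u (r * s).
Proof. exact: scalerA. Qed.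
Lemma ract1 (u : N) : ract u (1 : R) = u. Proof. exact: scale1r. Qed.

(** For r homogeneous of degree j this is (x e_n) r = (x r) e_(n + j). *)
Definition pullup_actf x r (m : int) : N :=
  \sum_(j \in [set: int]) ract (x (m - j)) r`_[j].

Lemma hcomp_supp r : exists2 A : seq int, uniq A &
  (forall n, n \notin A -> r`_[n] = 0).
Proof. by have [fr _ _] := hcompP (gr_grading R) r; apply: finsupp1. Qed.

Lemma pullup_actfE x r m (A : seq int) : uniq A ->
  (forall n, n \notin A -> r`_[n] = 0) ->
  pullup_actf x r m = \sum_(j <- A) ract (x (m - j)) r`_[j].
Proof.
by move=> uA h; apply: fsumE => // n nA; rewrite h// ract0.
Qed.

Lemma pullup_act_fin x r : finite_set [set m | pullup_actf x r m <> 0].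
Proof.
have [A uA hA] := hcomp_supp r; have [B uB hB] := finsupp1 (dsum_fin x).
apply: (@finsuppP _ _ [seq i + j | i <- B, j <- A]) => m hm.
rewrite (pullup_actfE _ _ uA hA) big1_seq// => j /= jA.
rewrite hB ?ract0l//; apply: contra hm => hm.
by apply/allpairsP; exists (m - j, j); split=> //=; rewrite subrK.
Qed.
Definition pullup_act (r : R^c) x : P := DSum (pullup_act_fin x r).

Lemma pullup_actE r x m : pullup_act r x m = pullup_actf x r m.
Proof. by []. Qed.

Lemma pullup_actDr : right_distributive pullup_act +%R.
Proof.
move=> r x y; apply: dsumP => m; rewrite dsumDE !pullup_actE.
have [A uA hA] := hcomp_supp r; rewrite !(pullup_actfE _ _ uA hA) -big_split.
by apply: eq_bigr => j _; rewrite dsumDE ractDl.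
Qed.

Lemma pullup_actDl x : {morph pullup_act^~ x : r s / r + s}.
Proof.
move=> r s; apply: dsumP => m; rewrite dsumDE !pullup_actE.
have [fr _ _] := hcompP (gr_grading R) r.
have [fs _ _] := hcompP (gr_grading R) s.
have [A uA [hr hs]] := finsupp2 fr fs.
rewrite (pullup_actfE _ _ uA hr) (pullup_actfE _ _ uA hs).
rewrite (@pullup_actfE _ _ _ A)//; last first.
  by move=> n nA; rewrite (hcompD (gr_grading R)) hr// hs// addr0.
rewrite -big_split; apply: eq_bigr => j _ /=.
by rewrite (hcompD (gr_grading R)) ractD.
Qed.

Lemma pullup_act_hom x j r : gr_comp j r ->
  forall m, pullup_act r x m = ract (x (m - j)) r.
Proof.
move=> hr m; have e := hcomp_hom (gr_grading R) hr.
rewrite pullup_actE (@pullup_actfE _ _ _ [:: j])//.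
  by rewrite big_seq1 e eqxx.
by move=> n; rewrite inE e => /negbTE ->.
Qed.

Lemma pullup_act1 : left_id 1 pullup_act.
Proof.
move=> x; have h : gr_comp 0 (1 : R).
  have [_ G _] := hcompP (gr_grading R) 1.
  by move: (G 0); rewrite hcomp1 eqxx.
by apply: dsumP => m; rewrite (pullup_act_hom _ h) ract1 subr0.
Qed.

Lemma pullup_act0 r : pullup_act r 0 = 0.
Proof. by apply: (addIr (pullup_act r 0)); rewrite -pullup_actDr !add0r. Qed.
Lemma pullup_0act x : pullup_act 0 x = 0.
Proof. by apply: (addIr (pullup_act 0 x)); rewrite -pullup_actDl !add0r. Qed.

Lemma pullup_actA (r s : R^c) x :
  pullup_act r (pullup_act s x) = pullup_act (r * s) x.
Proof.
pose T (u v : R) := pullup_act u (pullup_act v x) = pullup_act (v * u) x.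
suff: T r s by [].
move: r s; apply: (grading_ind (gr_grading R)).
- by move=> s; rewrite /T mulr0 !pullup_0act.
- by move=> u v hu hv s; rewrite /T mulrDr !pullup_actDl hu hv.
move=> i r hr; apply: (grading_ind (gr_grading R)).
- by rewrite /T mul0r !pullup_0act pullup_act0.
- by move=> u v hu hv; rewrite /T mulrDl !pullup_actDl pullup_actDr hu hv.
move=> j s hs; apply: dsumP => m.
rewrite (pullup_act_hom _ hr) (pullup_act_hom _ hs) ractM.
have hsr : gr_comp (j + i) ((s : R) * (r : R)) by apply: gr_mul.
by rewrite (pullup_act_hom _ hsr) opprD addrA addrAC.
Qed.

HB.instance Definition _ := GRing.Zmodule_isLmodule.Build R^c P
  pullup_actA pullup_act1 pullup_actDr pullup_actDl.

Definition pullup_comp (n : int) : set P := [set x | forall m, m != n -> x m = 0].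

Lemma pullup_single_fin n (u : N) :
  finite_set [set m : int | (if m == n then u else 0) <> 0].
Proof.
by apply: (@finsuppP _ _ [:: n]) => m; rewrite inE => /negbTE ->.
Qed.
Definition pullup_single n u : P := DSum (pullup_single_fin n u).

Lemma pullup_grading : is_grading pullup_comp.
Proof.
split=> [n|x].
  split=> [//|x y hx hy m mn]; by rewrite dsumDE dsumNE hx// hy// subr0.
have [A uA hA] := finsupp1 (dsum_fin x).
have h n : n \notin A -> pullup_single n (x n) = 0.
  by move=> nA; apply: dsumP => m /=; rewrite hA//; case: ifP.
exists (fun n => pullup_single n (x n)); split.
  split; first exact: finsuppP h.
    by move=> n m /= /negbTE ->.
  rewrite (fsumE uA h); apply: dsumP => m; rewrite dsum_sumE.
  have [mA|mA] := boolP (m \in A).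
    rewrite (bigD1_seq m)//= eqxx big1 ?addr0// => n nm.
    by rewrite eq_sym (negbTE nm).
  rewrite hA// big1_seq// => n /= nA; case: eqP => // mn.
  by move: mA; rewrite mn nA.
move=> f [ff hf ef]; apply/funext => n; apply: dsumP => m /=.
have [B uB hB] := finsupp1 ff.
case: eqP => [->|/eqP mn]; last by rewrite hf.
rewrite ef (fsumE uB hB) dsum_sumE.
have [nB|nB] := boolP (n \in B); last first.
  rewrite hB// big1_seq// => k /= kB; apply: hf.
  by apply: contraNneq nB => ->.
rewrite (bigD1_seq n)//= big1 ?addr0// => k kn.
by apply: hf; rewrite eq_sym.
Qed.

Lemma pullup_homact i j x r : pullup_comp i x -> gr_comp j r ->
  pullup_comp (i + j) (ract x r).
Proof.
move=> hx hr m mn; rewrite [LHS](pullup_act_hom _ hr) hx ?ract0l//.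
by rewrite subr_eq.
Qed.

Definition pullup : gradedMod R := GradedMod pullup_grading pullup_homact.

End Pullup.

Section GradedDirectSum.
Variables (R : gradedRing) (I : Type) (M : I -> gradedMod R).
Local Notation D := (direct_sum (fun i => forget (M i))).

Definition gdsum_comp (n : int) : set D :=
  [set x : D | forall i, gm_comp n ((x : dsum _) i)].

Lemma gdsum_part_fin (x : D) n :
  finite_set [set i | hcomp (gm_grading (M i)) ((x : dsum _) i) n <> 0].
Proof.
apply: sub_finite_set (dsum_fin x) => i /= h e; apply: h; rewrite e.
have h0 := (gm_grading (M i)).1 n.
by rewrite (hcomp_hom _ h0.1); case: ifP.
Qed.
Definition gdsum_part x n : D := DSum (gdsum_part_fin x n).

Lemma gdsum_part_supp x : finite_set [set n | gdsum_part x n <> 0].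
Proof.
apply: (@sub_finite_set _ _ (\bigcup_(i in [set i | (x : dsum _) i <> 0])
   [set n | hcomp (gm_grading (M i)) ((x : dsum _) i) n <> 0])).
  move=> n /= hn; apply: contrapT => h; apply: hn; apply: dsumP => i /=.
  apply: contrapT => hi; apply: h; exists i => //= xi; apply: hi; rewrite xi.
  have h0 := (gm_grading (M i)).1 n.
  by rewrite (hcomp_hom _ h0.1); case: ifP.
apply: bigcup_finite; first exact: dsum_fin.
by move=> i _; have [] := hcompP (gm_grading (M i)) ((x : dsum _) i).
Qed.

Lemma gdsum_grading : is_grading gdsum_comp.
Proof.
split=> [n|x].
  split=> [i|x y hx hy i]; have [h0 hB] := (gm_grading (M i)).1 n => //.
  exact: hB.
have fx := gdsum_part_supp x; have [A uA hA] := finsupp1 fx.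
exists (gdsum_part x); split.
  split=> //.
    by move=> n i /=; have [_ G _] := hcompP (gm_grading (M i)) ((x : dsum _) i).
  rewrite (fsumE uA hA); apply: dsumP => i; rewrite dsum_sumE.
  have [_ _ e] := hcompP (gm_grading (M i)) ((x : dsum _) i).
  rewrite [LHS]e; apply: fsumE => // n nA.
  by have /(congr1 (fun y : D => (y : dsum _) i)) := hA n nA.
move=> f [ff hf ef]; apply/funext => n; apply: dsumP => i /=.
have [B uB hB] := finsupp1 ff.
have hBi m : m \notin B -> (f m : dsum _) i = 0 by move=> mB; rewrite hB.
rewrite (@hcomp_uniq _ _ _ _ (fun m => (f m : dsum _) i))//.
- exact: finsuppP hBi.
- by move=> m; apply: hf.
- by rewrite ef (fsumE uB hB) (fsumE uB hBi) dsum_sumE.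
Qed.

Lemma gdsum_act i j (x : D) (r : R) : gdsum_comp i x -> gr_comp j r ->
  gdsum_comp (i + j) (ract x r).
Proof. by move=> hx hr k; apply: gm_act (hx k) hr. Qed.

Definition graded_direct_sum : gradedMod R := GradedMod gdsum_grading gdsum_act.

End GradedDirectSum.

Section GradedProduct.
Variables (R : gradedRing) (M N : gradedMod R).
Local Notation D := (forget M * forget N)%type.

Definition gprod_comp (n : int) : set D :=
  [set x | gm_comp n x.1 /\ gm_comp n x.2].

Lemma gprod_grading : is_grading gprod_comp.
Proof.
have hM := gm_grading M; have hN := gm_grading N.
have sum1 (A : seq int) (f : int -> D) :
    (\sum_(n <- A) f n).1 = \sum_(n <- A) (f n).1 by exact: big_morph.
have sum2 (A : seq int) (f : int -> D) :
    (\sum_(n <- A) f n).2 = \sum_(n <- A) (f n).2 by exact: big_morph.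
split=> [n|x].
  have [M0 MB] := hM.1 n; have [N0 NB] := hN.1 n.
  by split=> [//|x y [x1 x2] [y1 y2]]; split; [apply: MB | apply: NB].
have [f1 G1 e1] := hcompP hM x.1; have [f2 G2 e2] := hcompP hN x.2.
have [A1 _ h1] := finsupp1 f1; have [A2 _ h2] := finsupp1 f2.
pose A := undup (A1 ++ A2); have uA : uniq A by exact: undup_uniq.
have hA n : n \notin A -> hcomp hM x.1 n = 0 /\ hcomp hN x.2 n = 0.
  by rewrite mem_undup mem_cat negb_or => /andP[/h1 -> /h2 ->].
have hA' n : n \notin A -> (hcomp hM x.1 n, hcomp hN x.2 n) = 0 :> D.
  by move=> /hA[-> ->].
exists (fun n => (hcomp hM x.1 n, hcomp hN x.2 n)); split.
  split=> //; first exact: finsuppP hA'.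
  rewrite (fsumE uA hA') [LHS]surjective_pairing [RHS]surjective_pairing.
  rewrite sum1 sum2; congr pair; [rewrite [LHS]e1 | rewrite [LHS]e2].
    by apply: fsumE => // n /hA[].
  by apply: fsumE => // n /hA[].
move=> f [ff hf ef]; have [B uB hB] := finsupp1 ff.
have hB1 n : n \notin B -> (f n).1 = 0 by move=> /hB ->.
have hB2 n : n \notin B -> (f n).2 = 0 by move=> /hB ->.
apply/funext => n; rewrite [RHS]surjective_pairing; congr pair.
  rewrite (@hcomp_uniq _ _ _ _ (fun m => (f m).1))//; first exact: finsuppP hB1.
    by move=> m; have [] := hf m.
  by rewrite ef (fsumE uB hB) (fsumE uB hB1) sum1.
rewrite (@hcomp_uniq _ _ _ _ (fun m => (f m).2))//; first exact: finsuppP hB2.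
  by move=> m; have [] := hf m.
by rewrite ef (fsumE uB hB) (fsumE uB hB2) sum2.
Qed.

Lemma gprod_act i j (x : D) (r : R) : gprod_comp i x -> gr_comp j r ->
  gprod_comp (i + j) (ract x r).
Proof.
by case=> x1 x2 hr; split; [exact: (gm_act x1 hr) | exact: (gm_act x2 hr)].
Qed.

Definition graded_prod : gradedMod R :=
  @GradedMod R D gprod_comp gprod_grading gprod_act.

End GradedProduct.

(** Pure-projectivity in the category of graded modules and degree-preserving
    linear maps; a graded module is finitely presented when its underlying
    module is. *)
Definition graded_pure_projective (R : gradedRing) (M : gradedMod R) : Prop :=
  exists (I : Type) (F : I -> gradedMod R) (C : gradedMod R),
    (forall i, finitely_presented (forget (F i))) /\
    graded_iso (graded_direct_sum F) (graded_prod M C).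

(* Main.v *)
Require Import Defs.
From mathcomp Require Import all_boot all_order all_algebra.
From HB Require Import structures.
From mathcomp Require Import boolp classical_sets functions cardinality fsbigop.
From mathcomp Require Import zify.

(** Write V = p N and let R be right artinian.  If N is graded, the module p N is
    the graded direct sum of all the shifts of N, by the map [unshift].  By the
    Hopkins-Levitzki theorem [artinian_fg] finitely generated modules are
    finitely presented, so this gives pure-projectivity, and forgetting the
    grading identifies q p N with N^(omega).

    Conversely, pure-projectivity and an isomorphism q p N = N^(omega) have the
    same consequence: every x e_0 in V is fixed by a [small]
    endomorphism, that is, one of degree 0 with finitely generated image.  In
    the first case it is the sum of finitely many projections of a direct sum of
    finitely presented graded modules; in the second, N is a direct summand of
    q p N, by phi : N -> q p N and psi : q p N -> N say, and the endomorphism is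
    assembled from the homogeneous components of phi(x).

    From this [gradable_of_local_retracts] grades N step by step.  Suppose that
    a direct summand of N is already graded and that the complementary summand,
    the image of an idempotent e, is not zero.  By Fitting's lemma a small
    endomorphism fixing a nonzero x e_0, with x = e x, yields a nonzero
    graded projection g of V; choose g with minimal image G inside p (e N).
    As R has bounded support ([graded_artinian_bounded]), so has G, and p is
    adjoint to q on both sides: the inclusion G -> p N and the projection
    p N -> G correspond to maps q G -> N and N -> q G.  Their composite f on q G
    has identity degree 0 part, and its other homogeneous parts are nilpotent.
    By minimality of G the nilpotent homogeneous endomorphisms of G form a
    semigroup, and a nil semigroup acting on a module of finite length is
    nilpotent ([nil_semigroup]); so f is bijective and q G is a direct summand of
    e N.  It joins the graded summand, and the process ends because N is
    artinian.

    Submodules are sets, and homomorphisms are functions with a proof of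
    linearity, so that neither submodule types nor quotients are formed. *)

Set Implicit Arguments.
Unset Strict Implicit.
Unset Printing Implicit Defensive.

Import GRing.Theory.
Local Open Scope classical_set_scope.
Local Open Scope ring_scope.

(** * Submodules and chain conditions *)

Section LinearMaps.
Variables (K : pzRingType) (M N : lmodType K).

Lemma linear_bundle (f : M -> N) : linear f -> exists g : {linear M -> N}, g = f :> (M -> N).
Proof.
move=> hf; pose i := GRing.isLinear.Build K M N *:%R f hf.
pose g : {linear M -> N} := HB.pack f i.
by exists g.
Qed.

Lemma linD (f : M -> N) x y : linear f -> f (x + y) = f x + f y.
Proof. by case/linear_bundle=> g <-; rewrite linearD. Qed.
Lemma linB (f : M -> N) x y : linear f -> f (x - y) = f x - f y.
Proof. by case/linear_bundle=> g <-; rewrite linearB. Qed.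
Lemma linZ (f : M -> N) a x : linear f -> f (a *: x) = a *: f x.
Proof. by case/linear_bundle=> g <-; rewrite linearZ. Qed.
Lemma lin0 (f : M -> N) : linear f -> f 0 = 0.
Proof. by case/linear_bundle=> g <-; rewrite linear0. Qed.
Lemma lin_sum (f : M -> N) (J : Type) (s : seq J) (F : J -> M) : linear f ->
  f (\sum_(i <- s) F i) = \sum_(i <- s) f (F i).
Proof. by case/linear_bundle=> g <-; rewrite linear_sum. Qed.
End LinearMaps.

Section Submodules.
Variables (K : pzRingType) (M : lmodType K).
Implicit Types (A B C X : set M) (x y z : M) (s : seq M).

Definition submod A :=
  [/\ A 0, forall x y, A x -> A y -> A (x + y) & forall a x, A x -> A (a *: x)].

Definition lspan X : set M := [set y | forall A, submod A -> X `<=` A -> A y].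

Definition fg A := exists s, A = lspan [set` s].

Definition dcc A := forall C : nat -> set M, (forall n, submod (C n)) ->
  (forall n, C n.+1 `<=` C n) -> C 0 `<=` A ->
  exists n, forall m, (n <= m)%N -> C m = C n.

Definition addm A B : set M := [set z | exists x y, [/\ A x, B y & z = x + y]].

Lemma submodB A x y : submod A -> A x -> A y -> A (x - y).
Proof. by move=> [_ aD aZ] Ax Ay; apply: aD => //; rewrite -scaleN1r; apply: aZ. Qed.

Lemma submod_sum A (J : eqType) (r : seq J) (F : J -> M) : submod A ->
  (forall j, j \in r -> A (F j)) -> A (\sum_(j <- r) F j).
Proof.
move=> [a0 aD _] h; rewrite big_seq; elim/big_ind: _ => //.
Qed.

Lemma submod0 : submod [set 0].
Proof.
split=> // [x y -> ->|a x ->] /=; first by rewrite addr0.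
by rewrite scaler0.
Qed.

Lemma submodT : submod [set: M]. Proof. by []. Qed.

Lemma submodI A B : submod A -> submod B -> submod (A `&` B).
Proof.
move=> [a0 aD aZ] [b0 bD bZ]; split=> // [x y [? ?] [? ?]|a x [? ?]].
  by split; [apply: aD|apply: bD].
by split; [apply: aZ|apply: bZ].
Qed.

Lemma submod_lspan X : submod (lspan X).
Proof.
split=> [A []//|x y hx hy A hA XA|a x hx A hA XA]; case: (hA) => _ aD aZ.
  by apply: aD; [apply: hx|apply: hy].
by apply: aZ; apply: hx.
Qed.

Lemma sub_lspan X : X `<=` lspan X. Proof. by move=> x Xx A _; apply. Qed.

Lemma lspan_min X A : submod A -> X `<=` A -> lspan X `<=` A.
Proof. by move=> hA XA x; apply. Qed.

Lemma lspanS X Y : X `<=` Y -> lspan X `<=` lspan Y.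
Proof. by move=> XY; apply: lspan_min (submod_lspan _) _ => x /XY; apply: sub_lspan. Qed.

Lemma submod_addm A B : submod A -> submod B -> submod (addm A B).
Proof.
move=> [a0 aD aZ] [b0 bD bZ]; split.
- by exists 0, 0; rewrite addr0.
- move=> _ _ [x [y [Ax By ->]]] [x' [y' [Ax' By' ->]]].
  by exists (x + x'), (y + y'); rewrite addrACA; split=> //; [apply: aD|apply: bD].
- move=> a _ [x [y [Ax By ->]]]; exists (a *: x), (a *: y).
  by rewrite scalerDr; split=> //; [apply: aZ|apply: bZ].
Qed.

Lemma addm_subl A B : B 0 -> A `<=` addm A B.
Proof. by move=> B0 x Ax; exists x, 0; rewrite addr0. Qed.
Lemma addm_subr A B : A 0 -> B `<=` addm A B.
Proof. by move=> A0 x Bx; exists 0, x; rewrite add0r. Qed.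
Lemma addm_min A B C : submod C -> A `<=` C -> B `<=` C -> addm A B `<=` C.
Proof. by move=> [_ cD _] AC BC _ [x [y [/AC ? /BC ? ->]]]; apply: cD. Qed.

Lemma fg_submod A : fg A -> submod A.
Proof. by case=> s ->; apply: submod_lspan. Qed.

Lemma fg_lspan s : fg (lspan [set` s]). Proof. by exists s. Qed.

Lemma fg0 : fg [set 0].
Proof.
exists [::]; rewrite eqEsubset; split.
  by move=> _ ->; case: (submod_lspan [set` [::]]).
by apply: lspan_min submod0 _ => x.
Qed.

Lemma fg_addm A B : fg A -> fg B -> fg (addm A B).
Proof.
move=> fA fB; have [sA sB] := (fg_submod fA, fg_submod fB).
case: fA fB => s es [t et]; exists (s ++ t); rewrite eqEsubset; split.
  apply: addm_min (submod_lspan _) _ _; rewrite ?es ?et; apply: lspanS => x /= h;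
    by rewrite mem_cat h ?orbT.
apply: lspan_min (submod_addm sA sB) _ => x /=; rewrite mem_cat => /orP[] h.
  by apply: addm_subl; [case: sB | rewrite es; apply: sub_lspan].
by apply: addm_subr; [case: sA | rewrite et; apply: sub_lspan].
Qed.

Lemma submod_line x : submod (range (fun a : K => a *: x)).
Proof.
split; first by exists 0; rewrite ?scale0r.
  by move=> _ _ [a _ <-] [b _ <-]; exists (a + b); rewrite ?scalerDl.
by move=> a _ [b _ <-]; exists (a * b); rewrite ?scalerA.
Qed.

Lemma lspan_cons x s : lspan [set` x :: s] = addm (lspan [set` s]) (range (fun a : K => a *: x)).
Proof.
have sl := submod_line x; have ss := submod_lspan [set` s].
rewrite eqEsubset; split.
  apply: lspan_min (submod_addm ss sl) _ => y /=; rewrite inE => /orP[/eqP->|ys].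
    by apply: addm_subr; [case: ss | exists 1; rewrite ?scale1r].
  by apply: addm_subl; [case: sl | apply: sub_lspan].
apply: addm_min (submod_lspan _) _ _; first by apply: lspanS => y /= h; rewrite inE h orbT.
move=> _ [a _ <-]; have [_ _ h] := submod_lspan [set` x :: s].
by apply: h; apply: sub_lspan; apply: mem_head.
Qed.

Lemma fg_line x : fg (range (fun a : K => a *: x)).
Proof.
have e := lspan_cons x [::]; have [s hs] := fg0.
suff -> : range (fun a : K => a *: x) = lspan [set` [:: x]] by apply: fg_lspan.
rewrite e eqEsubset; split; first by apply: addm_subr; case: (submod_lspan [set` [::]]).
apply: addm_min (submod_line x) _ _ => //.
by apply: lspan_min (submod_line x) _.
Qed.

Lemma dccS A B : dcc B -> A `<=` B -> dcc A.
Proof. by move=> dB AB C sC dC CA; apply: dB => // x /CA /AB. Qed.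

(** Dependent choice turns the chain condition into the existence of minimal
    submodules. *)
Lemma dcc_min A (P : set M -> Prop) : dcc A ->
  (exists B, [/\ submod B, B `<=` A & P B]) ->
  exists B, [/\ submod B, B `<=` A, P B &
    forall C, submod C -> P C -> C `<=` B -> C = B].
Proof.
move=> dA [B0 hB0]; apply: contrapT => nex.
have next (B : {B | [/\ submod B, B `<=` A & P B]}) :
    exists C : {B | [/\ submod B, B `<=` A & P B]},
      sval C `<=` sval B /\ sval C <> sval B.
  apply: contrapT => h; apply: nex; exists (sval B).
  case: B h => B /= [sB BA PB] h; split=> // C sC PC CB.
  apply: contrapT => CnB; apply: h.
  have hC : [/\ submod C, C `<=` A & P C] by split=> // x /CB /BA.
  by exists (exist _ C hC).
have [g hg] := choice next.
pose c n := iter n g (exist _ B0 hB0).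
have [||| n hn] := dA (fun n => sval (c n)).
- by move=> n; case: (svalP (c n)).
- by move=> n; case: (hg (c n)).
- by case: (hB0).
by case: (hg (c n)) => _; apply; apply: (hn n.+1 (leqnSn n)).
Qed.

(** If a finitely generated submodule is the union of an increasing sequence,
    its generators occur at a finite stage; so sequences whose unions are
    finitely generated cannot grow for ever. *)
Lemma fg_max (P : set M -> Prop) :
  (exists B, submod B /\ P B) ->
  (forall C : nat -> set M, (forall n, submod (C n)) -> (forall n, P (C n)) ->
     (forall n, C n `<=` C n.+1) -> submod (\bigcup_n C n) -> fg (\bigcup_n C n)) ->
  exists B, [/\ submod B, P B & forall C, submod C -> P C -> B `<=` C -> C = B].
Proof.
move=> [B0 hB0] hfg; apply: contrapT => nex.
have next (B : {B | submod B /\ P B}) :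
    exists C : {B | submod B /\ P B}, sval B `<=` sval C /\ sval C <> sval B.
  apply: contrapT => h; apply: nex; exists (sval B).
  case: B h => B /= [sB PB] h; split=> // C sC PC CB.
  apply: contrapT => CnB; apply: h.
  by exists (exist _ C (conj sC PC)).
have [g hg] := choice next.
pose c n := iter n g (exist _ B0 hB0).
have sc n : submod (sval (c n)) by case: (svalP (c n)).
have cS n : sval (c n) `<=` sval (c n.+1) by case: (hg (c n)).
have cmon m n : (m <= n)%N -> sval (c m) `<=` sval (c n).
  elim: n => [|n IH]; first by rewrite leqn0 => /eqP ->.
  by rewrite leq_eqVlt => /orP[/eqP->//|/IH h]; apply: subset_trans h (cS n).
have sU : submod (\bigcup_n sval (c n)).
  split; first by exists 0%N => //; case: (sc 0%N).
    move=> x y [m _ hx] [n _ hy]; exists (maxn m n) => //.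
    have [_ cD _] := sc (maxn m n); apply: cD.
      by apply: cmon hx; apply: leq_maxl.
    by apply: cmon hy; apply: leq_maxr.
  by move=> a x [m _ hx]; exists m => //; case: (sc m) => _ _; apply.
have pc n : P (sval (c n)) by case: (svalP (c n)).
have [s es] := hfg (fun n => sval (c n)) sc pc cS sU.
have [n hn] : exists n, [set` s] `<=` sval (c n).
  have : [set` s] `<=` \bigcup_n sval (c n) by rewrite es; apply: sub_lspan.
  elim: s {es} => [|x s IH] h; first by exists 0%N.
  have [n hn] : exists n, [set` s] `<=` sval (c n).
    by apply: IH => y /= ys; apply: h; rewrite /= inE ys orbT.
  have [m _ hm] : (\bigcup_n sval (c n)) x by apply: h; rewrite /= inE eqxx.
  exists (maxn m n) => y /=; rewrite inE => /orP[/eqP->|ys].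
    by apply: cmon hm; apply: leq_maxl.
  by apply: cmon (hn y ys); apply: leq_maxr.
have : sval (c n.+1) `<=` sval (c n).
  move=> x hx; have : (\bigcup_n sval (c n)) x by exists n.+1.
  by rewrite es; apply: lspan_min.
by case: (hg (c n)) => h1 h2 h3; apply: h2; rewrite eqEsubset.
Qed.

End Submodules.

Definition artinian (K : pzRingType) := dcc [set: K^o].

Section Images.
Variables (K : pzRingType) (M N : lmodType K).

Lemma submod_image (f : M -> N) (A : set M) : linear f -> submod A -> submod (f @` A).
Proof.
move=> lf [a0 aD aZ]; split; first by exists 0 => //; rewrite lin0.
  by move=> _ _ [x Ax <-] [y Ay <-]; exists (x + y); [apply: aD|rewrite linD].
by move=> a _ [x Ax <-]; exists (a *: x); [apply: aZ|rewrite linZ].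
Qed.

Lemma submod_preimage (f : M -> N) (A : set N) : linear f -> submod A -> submod (f @^-1` A).
Proof.
move=> lf [a0 aD aZ]; split; rewrite /preimage /=.
- by rewrite lin0.
- by move=> x y Ax Ay; rewrite linD//; apply: aD.
- by move=> a x Ax; rewrite linZ//; apply: aZ.
Qed.

Lemma fg_image (f : M -> N) (A : set M) : linear f -> fg A -> fg (f @` A).
Proof.
move=> lf fA; have sA := fg_submod fA; case: fA => s es.
exists [seq f x | x <- s]; rewrite eqEsubset; split; last first.
  apply: lspan_min; first exact: submod_image.
  by move=> _ /= /mapP[x xs ->]; exists x => //; rewrite es; apply: sub_lspan.
rewrite es => _ [x hx <-]; move: x hx; apply: lspan_min.
  exact: (submod_preimage lf (submod_lspan _)).
by move=> x /= xs; apply: sub_lspan; apply/mapP; exists x.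
Qed.
End Images.

Section Artinian.
Variables (K : pzRingType).
Hypothesis artK : artinian K.

(** By induction on the generators: a chain in A + Kx is controlled by its traces
    on A and by the left ideals of the coefficients of x modulo A. *)
Lemma dcc_fg (M : lmodType K) (A : set M) : fg A -> dcc A.
Proof.
case=> s ->; elim: s => [|x s IH].
  move=> C sC dC C0; exists 0%N.
  suff h m : C m = [set 0] by move=> m _; rewrite !h.
  have hm : C m `<=` C 0%N by elim: m => // m IH; apply: subset_trans (dC m) IH.
  rewrite eqEsubset; split=> [y /hm /C0 h|_ ->]; last by case: (sC m).
  by apply: (lspan_min (@submod0 K M) _ h) => z.
rewrite lspan_cons; set A0 := lspan _ in IH *; have sA0 : submod A0 by apply: submod_lspan.
move=> C sC dC C0.
have [||| n1 h1] := IH (fun n => C n `&` A0).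
- by move=> n; apply: submodI.
- by move=> n; apply: setSI.
- by move=> y [].
pose D n : set K^o := (fun r : K^o => (r : K) *: x) @^-1` (addm (C n) A0).
have lx : linear (fun r : K^o => (r : K) *: x).
  by move=> a u v; rewrite scalerDl -scalerA.
have [||| n2 h2] := artK (C := D).
- by move=> n; apply: (submod_preimage lx); apply: submod_addm.
- by move=> n r [y [z [Cy Az e]]]; exists y, z; split=> //; apply: dC.
- by [].
exists (maxn n1 n2) => m hm; set n := maxn n1 n2.
have hmn : C m `<=` C n.
  rewrite /n; elim: m hm => [|m IHm]; first by rewrite leqn0 => /eqP->.
  rewrite leq_eqVlt => /orP[/eqP->//|/IHm]; exact: subset_trans (dC m).
have e1 : C m `&` A0 = C n `&` A0.
  by rewrite (h1 m (leq_trans (leq_maxl _ _) hm)) (h1 n (leq_maxl _ _)).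
have e2 : D m = D n.
  by rewrite (h2 m (leq_trans (leq_maxr _ _) hm)) (h2 n (leq_maxr _ _)).
rewrite eqEsubset; split=> // y Cy.
have hn0 : C n `<=` C 0%N.
  by elim: n {hmn e1 e2 Cy} => // n IHn; apply: subset_trans (dC n) IHn.
have [u [v [Au [r _ ev] ey]]] := C0 y (hn0 y Cy).
have : D n r.
  exists y, (- u); split=> //; last by rewrite ev ey addrAC subrr add0r.
  by rewrite -scaleN1r; case: sA0 => _ _; apply.
rewrite -e2 => -[c [w [Cc Aw ec]]].
have Cyc : (C n `&` A0) (y - c).
  split; first by apply: submodB => //; apply: hmn.
  rewrite ey -ev ec [c + w]addrC addrA addrK.
  by case: sA0 => _ aD _; apply: aD.
rewrite -e1 in Cyc; case: Cyc => Cyc _.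
by rewrite -(subrK c y); case: (sC m) => _ cD _; apply: cD.
Qed.
End Artinian.

(** * Artinian rings are Noetherian *)

Section Hopkins.
Variables (K : pzRingType).
Hypothesis artK : artinian K.
Variable M : lmodType K.
Implicit Types (A B C I : set M) (T Q : set K^o) (x y z : M).

Definition idealmul T I : set M :=
  lspan [set z | exists (t : K) x, [/\ T t, I x & z = t *: x]].

Lemma submod_idealmul T I : submod (idealmul T I).
Proof. exact: submod_lspan. Qed.

Lemma mem_idealmul T I (t : K) x : T t -> I x -> idealmul T I (t *: x).
Proof. by move=> Tt Ix; apply: sub_lspan; exists t, x. Qed.

Lemma idealmul_min T I A : submod A -> (forall (t : K) x, T t -> I x -> A (t *: x)) ->
  idealmul T I `<=` A.
Proof.
by move=> sA h; apply: lspan_min sA _ => _ [t [x [Tt Ix ->]]]; apply: h.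
Qed.

Definition lprincipal (t : K) : set K^o := range (fun a : K => (a * t : K^o)).

Lemma submod_lprincipal t : submod (lprincipal t).
Proof. exact: (@submod_line K K^o (t : K^o)). Qed.

Lemma linear_scaler x : linear (fun r : K^o => (r : K) *: x).
Proof. by move=> a u v; rewrite scalerDl -scalerA. Qed.

(** The coefficients t in T are determined on the finite set s by finitely many
    of them, because T x is a submodule of the Noetherian module K x. *)
Lemma ideal_fg_mod_ann T (s : seq M) : submod T ->
  (forall x, x \in s -> forall B, submod B -> B `<=` range (fun a : K => a *: x) -> fg B) ->
  exists ts : seq K^o, [set` ts] `<=` T /\
    forall t, T t -> exists2 u : K^o, lspan [set` ts] u &
      forall x, x \in s -> (t : K) *: x = (u : K) *: x.
Proof.
elim: s T => [|x s IH] T sT hs.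
  exists [::]; split=> // t Tt; exists 0 => //.
  by case: (submod_lspan [set` [::] : seq K^o]).
pose f (r : K^o) := (r : K) *: x; have lf : linear f by apply: linear_scaler.
have [|s1 e1] := hs x (mem_head _ _) (f @` T) (submod_image lf sT).
  by move=> _ [t Tt <-]; exists t.
have [ts1 [hts1 e1']] : exists ts1 : seq K^o, [set` ts1] `<=` T /\ [set` s1] `<=` f @` lspan [set` ts1].
  have : [set` s1] `<=` f @` T by rewrite e1; apply: sub_lspan.
  elim: s1 {e1} => [|y s1 IH1] h1; first by exists [::].
  have [|ts [hts e]] := IH1; first by move=> z /= zs; apply: h1; rewrite /= inE zs orbT.
  have [t Tt et] := h1 y (mem_head _ _).
  exists (t :: ts); split=> z /=; rewrite inE => /orP[/eqP->//|]; first exact: hts.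
    by exists t => //; apply: sub_lspan; apply: mem_head.
  move=> /e[u hu <-]; exists u => //; apply: lspanS hu => v /= vs.
  by rewrite inE vs orbT.
have e2 : f @` T `<=` f @` lspan [set` ts1].
  by rewrite e1; apply: lspan_min e1'; apply: submod_image lf (submod_lspan _).
pose T' : set K^o := T `&` f @^-1` [set 0].
have sT' : submod T' by apply: submodI sT (submod_preimage lf (@submod0 _ _)).
have [|ts2 [hts2 e3]] := IH T' sT'; first by move=> y ys; apply: hs; rewrite inE ys orbT.
exists (ts1 ++ ts2); split.
  by move=> t /=; rewrite mem_cat => /orP[/hts1//|/hts2[]].
have sub1 : lspan [set` ts1] `<=` lspan [set` ts1 ++ ts2].
  by apply: lspanS => v /= vs; rewrite mem_cat vs.
have sub2 : lspan [set` ts2] `<=` lspan [set` ts1 ++ ts2].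
  by apply: lspanS => v /= vs; rewrite mem_cat vs orbT.
move=> t Tt; have [u hu eu] := e2 (f t) (imageP f Tt).
have Tu : T u by apply: lspan_min sT hts1 _ hu.
have [|v hv ev] := e3 (t - u).
  split; first exact: submodB.
  by rewrite /preimage /= linB// eu subrr.
exists (u + v).
  have [_ h _] := submod_lspan [set` ts1 ++ ts2].
  by apply: h; [apply: sub1 | apply: sub2].
have v0 : (v : K) *: x = 0.
  by have [] : T' v by apply: lspan_min sT' hts2 _ hv.
move=> y; rewrite inE => /orP[/eqP->|ys].
  by rewrite scalerDl v0 addr0 -/(f u) eu.
by rewrite scalerDl -ev// scalerBl addrC subrK.
Qed.

(** The Hopkins-Levitzki theorem.  A minimal counterexample I is the sum of no
    two proper submodules.  Take T minimal among the left ideals with T I = I.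
    Modulo the annihilator of I, the ideal T is finitely generated, so that
    (K t) I = I for some t in T.  Every such t generates T, and the other
    elements of T form a left ideal Q with Q I <> I, the largest proper one.  So
    each T x, for x in I, is simple or zero modulo Q I, hence I is semisimple
    modulo Q I, and a simple summand has a proper complement: a contradiction. *)
Theorem artinian_fg A : dcc A -> forall B, submod B -> B `<=` A -> fg B.
Proof.
move=> dA B0 sB0 BA0; apply: contrapT => nB0.
have [|I [sI IA nI minI]] := dcc_min (P := fun B => ~ fg B) dA; first by exists B0.
have properfg B : submod B -> B `<=` I -> B <> I -> fg B.
  by move=> sB BI nB; apply: contrapT => /(minI _ sB)/(_ BI).
have hollow B C : submod B -> submod C -> B `<=` I -> C `<=` I ->
    I `<=` addm B C -> B = I \/ C = I.
  move=> sB sC BI CI IBC; apply: contrapT => /not_orP[nB nC]; apply: nI.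
  have -> : I = addm B C by rewrite eqEsubset; split=> //; apply: addm_min.
  by apply: fg_addm; apply: properfg.
have mulI T : idealmul T I `<=` I.
  by apply: idealmul_min (sI) _ => t x _; case: (sI) => _ _; apply.
have [|T [sT _ TI minT]] := dcc_min (P := fun T => I `<=` idealmul T I) artK.
  exists setT; split=> // x Ix; rewrite -(scale1r x); exact: mem_idealmul.
pose ann (s : seq M) : set K^o := [set t | forall x, x \in s -> (t : K) *: x = 0].
have sann s : submod (ann s).
  split=> [x _|t u ht hu x xs|a t ht x xs]; first by rewrite scale0r.
    by rewrite scalerDl ht// hu// addr0.
  by rewrite -scalerA ht// scaler0.
have [|_ [_ _ [s sI' ->] mins]] :=
    dcc_min (P := fun Q => exists2 s, [set` s] `<=` I & Q = ann s) artK.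
  by exists (ann [::]); split=> //; exists [::].
have annI x (t : K) : I x -> ann s t -> t *: x = 0.
  move=> Ix; rewrite -(mins (ann (x :: s)))//.
  - by apply; apply: mem_head.
  - exists (x :: s) => // y /=; rewrite inE => /orP[/eqP->//|]; exact: sI'.
  - by move=> u hu y ys; apply: hu; rewrite inE ys orbT.
have linefg x : I x -> forall B, submod B -> B `<=` range (fun a : K => a *: x) -> fg B.
  move=> Ix B sB Bx.
  have lI : range (fun a : K => a *: x) `<=` I by move=> _ [a _ <-]; case: (sI) => _ _; apply.
  apply: properfg => // [y /Bx /lI//|eB]; apply: nI.
  have -> : I = range (fun a : K => a *: x) by rewrite eqEsubset; split=> //; rewrite -eB.
  exact: fg_line.
have [ts [hts ets]] : exists ts : seq K^o, [set` ts] `<=` T /\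
    forall t, T t -> exists2 u : K^o, lspan [set` ts] u & forall x, I x -> (t : K) *: x = (u : K) *: x.
  have [|ts [hts ets]] := @ideal_fg_mod_ann T s sT; first by move=> x /sI'; apply: linefg.
  exists ts; split=> // t /ets[u hu eu]; exists u => // x Ix.
  apply/eqP; rewrite -subr_eq0 -scalerBl; apply/eqP; apply: annI => //.
  by move=> y ys; rewrite scalerBl eu// subrr.
(* I is the sum of the (K t) I over finitely many t, and proper ones are f.g. *)
have [t Tt tI] : exists2 t : K, T t & I `<=` idealmul (lprincipal t) I.
  apply: contrapT => nt; apply: nI.
  have fgp (t : K) : T t -> fg (idealmul (lprincipal t) I).
    move=> Tt; apply: properfg => //; first exact: submod_idealmul.
    by move=> e; apply: nt; exists t; rewrite ?e.
  suff [C [fC CI hC]] : exists C, [/\ fg C, C `<=` I & forall (t : K^o) x, t \in ts -> I x -> C ((t : K) *: x)].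
    have sC := fg_submod fC.
    suff -> : I = C by [].
    rewrite eqEsubset; split=> //; apply: subset_trans TI _.
    apply: idealmul_min => // t x /ets[u hu eu] Ix; rewrite eu//.
    apply: (lspan_min (submod_preimage (linear_scaler x) sC) _ hu) => v /= vs.
    exact: hC.
  elim: ts hts {ets} => [|t ts IH] hts; first by exists [set 0]; split=> //;
     [exact: fg0|move=> _ ->; case: (sI)].
  have [|C [fC CI hC]] := IH; first by move=> v /= vs; apply: hts; rewrite /= inE vs orbT.
  have Tt : T t by apply: hts; apply: mem_head.
  exists (addm (idealmul (lprincipal t) I) C); split.
  - by apply: fg_addm => //; apply: fgp.
  - by apply: addm_min.
  - move=> u x; rewrite inE => /orP[/eqP->|us] Ix.
      apply: addm_subl; first by case: (fg_submod fC).
      by apply: mem_idealmul => //; exists 1; rewrite ?mul1r.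
    apply: addm_subr; first by case: (submod_idealmul (lprincipal t) I).
    exact: hC.
have lT (a : K) : T a -> lprincipal a `<=` T.
  by move=> Ta _ [b _ <-]; case: sT => _ _; apply.
have minl (a : K) : T a -> I `<=` idealmul (lprincipal a) I -> lprincipal a = T.
  by move=> Ta aI; apply: minT => //; [apply: submod_lprincipal | apply: lT].
pose Q : set K^o := [set a | T a /\ ~ I `<=` idealmul (lprincipal a) I].
have sQ : submod Q.
  split.
  - split; first by case: sT.
    move=> h; apply: nI; suff -> : I = [set 0] by apply: fg0.
    rewrite eqEsubset; split=> [|_ ->]; last by case: (sI).
    apply: subset_trans h _; apply: idealmul_min (@submod0 K M) _ => _ x [a _ <-] _.
    by rewrite mulr0 scale0r.
  - move=> a b [Ta na] [Tb nb]; split; first by case: sT => _ h _; apply: h.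
    move=> h; have [|||||e|e] :=
        hollow (idealmul (lprincipal a) I) (idealmul (lprincipal b) I).
    + exact: submod_idealmul.
    + exact: submod_idealmul.
    + exact: mulI.
    + exact: mulI.
    + apply: subset_trans h _; apply: idealmul_min.
        by apply: submod_addm; apply: submod_idealmul.
      move=> _ x [c _ <-] Ix; rewrite mulrDr scalerDl.
      exists ((c * a) *: x), ((c * b) *: x); split=> //; apply: mem_idealmul => //.
        by exists c.
      by exists c.
    + by apply: na; rewrite e.
    + by apply: nb; rewrite e.
  - move=> c a [Ta na]; split; first by case: sT => _ _; apply.
    move=> h; apply: na; apply: subset_trans h _.
    apply: idealmul_min; first exact: submod_idealmul.
    by move=> _ x [b _ <-] Ix; apply: mem_idealmul => //; exists (b * c); rewrite -?mulrA.
have QT : Q `<=` T by move=> a [].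
have nQI : ~ I `<=` idealmul Q I.
  move=> h; have eQ := minT Q sQ h QT.
  by have : T t by []; rewrite -eQ => -[].
pose I0 := idealmul Q I; have sI0 : submod I0 by apply: submod_idealmul.
have I0I : I0 `<=` I by apply: mulI.
have simple (a b : K) x : T a -> T b -> I x -> ~ I0 (a *: x) -> exists c, b *: x = c *: (a *: x).
  move=> Ta Tb Ix na; have e : lprincipal a = T.
    apply: minl => //; apply: contrapT => h; apply: na.
    by apply: mem_idealmul.
  have : lprincipal a b by rewrite e.
  by case=> c _ <-; exists c; rewrite scalerA.
have [a0 [x0 [Ta0 Ix0 nz]]] : exists (a : K) x, [/\ T a, I x & ~ I0 (a *: x)].
  apply: contrapT => h; apply: nQI; apply: subset_trans TI _.
  apply: idealmul_min => // a x Ta Ix; apply: contrapT => hn.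
  by apply: h; exists a, x.
set z := a0 *: x0 in nz; have Iz : I z by case: (sI) => _ _; apply.
(* C is a complement of K z modulo Q I; chains of such C stop growing, since
   their unions omit z and so are proper submodules of I. *)
have [||C [sC [CI I0C nCz] maxC]] := fg_max (P := fun C => [/\ C `<=` I, I0 `<=` C & ~ C z]).
- by exists I0; split=> //; split.
- move=> C sC PC incC sU; apply: properfg => //.
    by move=> x [n _ hx]; case: (PC n) => h _ _; apply: h.
  by move=> e; have : I z by []; rewrite -e => -[n _]; case: (PC n).
have eI : I `<=` addm C (range (fun a : K => a *: z)).
  have sCz := submod_addm sC (submod_line z).
  have CCz : C `<=` addm C (range (fun a : K => a *: z)).
    by apply: addm_subl; case: (submod_line z).
  apply: subset_trans TI _; apply: idealmul_min => // b y Tb Iy.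
  have [Cby|nCby] := pselect (C (b *: y)); first exact: CCz.
  pose C' := addm C (range (fun a : K => a *: (b *: y))).
  have sby := submod_line (b *: y).
  have sC' : submod C' by apply: submod_addm.
  have CC' : C `<=` C' by apply: addm_subl; case: sby.
  have Ib : range (fun a : K => a *: (b *: y)) `<=` I.
    by move=> _ [k _ <-]; case: (sI) => _ _ hI; do 2 apply: (hI).
  have C'z : C' z.
    apply: contrapT => nz'; apply: nCby; rewrite -(maxC C')//.
      by apply: addm_subr; [case: sC | exists 1; rewrite ?scale1r].
    split=> //; last by apply: subset_trans CC'.
    exact: addm_min.
  case: C'z => c [_ [Cc [k _ <-] ez]].
  have nk : ~ I0 ((k * b) *: y).
    move=> /I0C h; apply: nCz; rewrite ez; case: (sC) => _ hD _; apply: hD => //.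
    by rewrite scalerA.
  have [|l ->] := simple (k * b) b y _ Tb Iy nk; first by case: sT => _ _; apply.
  have -> : (k * b) *: y = - c + z by rewrite ez addKr scalerA.
  rewrite scalerDr; exists (l *: - c), (l *: z); split=> //.
  by case: (sC) => h0 _ h; apply: (h); rewrite -scaleN1r; apply: (h).
apply: nI; suff -> : I = addm C (range (fun a : K => a *: z)).
  apply: fg_addm (fg_line z); apply: properfg => //.
  by move=> e; apply: nCz; rewrite e.
rewrite eqEsubset; split=> //; apply: addm_min => //.
by move=> _ [a _ <-]; case: (sI) => _ _; apply.
Qed.

End Hopkins.

(** Together with [dcc_fg], this gives both chain conditions below a finitely
    generated submodule. *)
Lemma artinian_fgS (K : pzRingType) (M : lmodType K) (A B : set M) :
  artinian K -> fg A -> submod B -> B `<=` A -> fg B.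
Proof. by move=> aK /(dcc_fg aK) dA; apply: artinian_fg. Qed.

(** * Nil semigroups and Fitting projections *)

Section Endomorphisms.
Variables (K : pzRingType) (M : lmodType K).
Implicit Types (A B X Y : set M) (f s t : M -> M).

Lemma linear_comp (M1 M2 M3 : lmodType K) (g : M2 -> M3) (f : M1 -> M2) :
  linear g -> linear f -> linear (g \o f).
Proof. by move=> lg lf a x y; rewrite /= lf lg. Qed.

Lemma linear_iter f k : linear f -> linear (iter k f).
Proof. by move=> lf; elim: k => // k IH a x y; rewrite /= IH lf. Qed.

Definition noeth X := forall B, submod B -> B `<=` X -> fg B.

(** In a nonzero X take a maximal proper submodule Y stable under S, and s in S
    with s X + Y minimal but larger than Y.  Let r be the identity or in S.  Then
    s r s X lies in Y: otherwise s X lies in (s r) s X + Y, and iterating the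
    nilpotent s r puts s X into Y.  Hence the elements that all the s r map into
    Y form an S-stable submodule containing Y and s X, so all of X: a
    contradiction. *)
Lemma nil_semigroup X (S : set (M -> M)) :
  dcc X -> noeth X -> submod X ->
  (forall s, S s -> linear s) -> (forall s t, S s -> S t -> S (s \o t)) ->
  (forall s x, S s -> X x -> X (s x)) ->
  (forall s, S s -> exists k, forall x, X x -> iter k s x = 0) ->
  X `<=` lspan [set y | exists s x, [/\ S s, X x & y = s x]] -> X `<=` [set 0].
Proof.
move=> dX nX sX Slin Scomp SX Snil XSX; apply: contrapT => X0.
have [||Y [sY [YX SY nXY] maxY]] :=
    fg_max (P := fun Y => [/\ Y `<=` X, forall s y, S s -> Y y -> Y (s y) & ~ X `<=` Y]).
- exists [set 0]; split; first exact: submod0.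
  split=> // [_ ->|s _ /Slin ls ->]; first by case: (sX).
  by rewrite lin0.
- by move=> C sC PC _ sU; apply: nX => // x [n _ Cx]; case: (PC n) => h _ _; apply: h.
have [s0 [Ss0 ns0]] : exists s, S s /\ ~ s @` X `<=` Y.
  apply: contrapT => h; apply: nXY; apply: subset_trans XSX _.
  apply: lspan_min sY _ => _ [s [x [Ss Xx ->]]]; apply: contrapT => nY; apply: h.
  by exists s; split=> // h; apply: nY; apply: h; exists x.
have YaY s : addm (s @` X) Y `<=` Y -> s @` X `<=` Y.
  by apply: subset_trans; apply: addm_subl; case: (sY).
have [|_ [_ _ [s [Ss -> ns]] mins]] :=
    dcc_min (P := fun B => exists s, [/\ S s, B = addm (s @` X) Y & ~ s @` X `<=` Y]) dX.
  exists (addm (s0 @` X) Y); split; last by exists s0.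
    by apply: submod_addm sY; apply: submod_image sX; apply: Slin.
  by apply: addm_min => // _ [x Xx <-]; apply: SX.
pose S1 r := S r \/ r = id.
have S1lin r : S1 r -> linear r by case=> [/Slin//|->].
have S1X r x : S1 r -> X x -> X (r x) by case=> [/SX|->//]; apply.
have S1Y r y : S1 r -> Y y -> Y (r y) by case=> [/SY|->//]; apply.
have S1r r t : S1 r -> S t -> S (r \o t) by case=> [/Scomp|->//]; apply.
have S1l r t : S1 r -> S t -> S (t \o r) by case=> [Sr St|->//]; apply: Scomp.
have srs r x : S1 r -> X x -> Y (s (r (s x))).
  move=> Sr Xx; apply: contrapT => nY.
  have Ssr : S (s \o r) by apply: S1l.
  have Ssrs : S (s \o r \o s) by apply: Scomp.
  have e : addm ((s \o r \o s) @` X) Y = addm (s @` X) Y.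
    apply: mins.
    - by apply: submod_addm sY; apply: submod_image sX; apply: Slin.
    - exists (s \o r \o s); split=> //.
      by move=> h; apply: nY; apply: h; exists x.
    - apply: addm_min; first by apply: submod_addm sY; apply: submod_image sX; apply: Slin.
        move=> _ [y Xy <-]; apply: addm_subl; first by case: (sY).
        by exists (r (s y)) => //; apply: S1X => //; apply: SX.
      by apply: addm_subr; exists 0; [case: (sX)|rewrite lin0//; apply: Slin].
  have hk k : s @` X `<=` addm ((iter k (s \o r) \o s) @` X) Y.
    elim: k => [|k IH]; first by apply: addm_subl; case: (sY).
    move=> _ [y Xy <-].
    have : addm (s @` X) Y (s y) by apply: addm_subl; [case: (sY)|exists y].
    rewrite -e => -[_ [v [[w Xw <-] Yv ->]]].
    have [_ [v' [[w' Xw' <-] Yv' ew]]] := IH (s w) (imageP s Xw).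
    exists (iter k.+1 (s \o r) (s w')), (s (r v') + v); split.
    + by exists w'.
    + by case: (sY) => _ hD _; apply: hD => //; apply: SY => //; apply: S1Y.
    + by rewrite /= ew (linD _ _ (S1lin _ Sr)) (linD _ _ (Slin _ Ss)) addrA.
  have [k nilk] := Snil _ Ssr; apply: ns => _ [y Xy <-].
  have [_ [v [[w Xw <-] Yv ->]]] := hk k (s y) (imageP s Xy).
  by rewrite /= nilk ?add0r//; apply: SX.
pose Z : set M := [set x | X x /\ forall r, S1 r -> Y (s (r x))].
have sZ : submod Z.
  have [X0' XD XZ] := sX; have [Y0 YD YZ] := sY; have ls := Slin _ Ss.
  split.
  - by split=> // r /S1lin lr; rewrite (lin0 lr) (lin0 ls).
  - move=> x y [Xx hx] [Xy hy]; split; first exact: XD.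
    by move=> r Sr; rewrite (linD _ _ (S1lin _ Sr)) (linD _ _ ls); apply: YD; [exact: hx|exact: hy].
  - move=> a x [Xx hx]; split; first exact: XZ.
    by move=> r Sr; rewrite (linZ _ _ (S1lin _ Sr)) (linZ _ _ ls); apply: YZ; apply: hx.
have sXZ : s @` X `<=` Z.
  by move=> _ [x Xx <-]; split; [apply: SX|move=> r Sr; apply: srs].
have [XZ|nXZ] := pselect (X `<=` Z).
  by apply: ns => _ [x /XZ[_ h] <-]; apply: (h id); right.
apply: ns; rewrite -(maxY Z)//.
  split=> // [x []//|t x St [Xx hx]]; split; first exact: SX.
  by move=> r Sr; apply: (hx (r \o t)); left; apply: S1r.
move=> y Yy; split; first exact: YX.
by move=> r Sr; apply: SY => //; apply: S1Y.
Qed.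

Lemma injective_dcc_surjective X f : dcc X -> submod X -> linear f ->
  (forall x, X x -> X (f x)) -> (forall x, X x -> f x = 0 -> x = 0) ->
  X `<=` f @` X.
Proof.
move=> dX sX lf fX inj.
have [|||n hn] := dX (fun n => iter n f @` X).
- by move=> n; apply: submod_image sX; apply: linear_iter.
- move=> n _ [x Xx <-]; exists (f x); first exact: fX.
  by rewrite -iterSr.
- by move=> _ [x Xx <-].
move=> x Xx; have : (iter n.+1 f @` X) (iter n f x) by rewrite hn//; exists x.
case=> y Xy; rewrite iterSr => e; exists y; first by [].
have : iter n f (f y - x) = 0 by rewrite (linB _ _ (linear_iter n lf)) e subrr.
have : X (f y - x) by apply: submodB => //; apply: fX.
suff h z : X z -> iter n f z = 0 -> z = 0 by move=> Xz /(h _ Xz)/eqP; rewrite subr_eq0 => /eqP.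
elim: n {hn e} z => [|n IH] z Xz //; rewrite iterSr => /IH h.
by apply: inj => //; apply: h; apply: fX.
Qed.

(** Fitting's lemma: g is the projection onto the image of f^k along its kernel.
    The last clause characterises the values of g, so that compatibility of g
    with gradings can be deduced from that of f. *)
Lemma fitting f : linear f -> dcc (range f) -> noeth (range f) ->
  exists k g, [/\ (0 < k)%N, linear g,
    forall v, exists2 u, g v = iter k f u & iter k f (g v) = iter k f v
    & forall u v, iter k f (iter k f u) = iter k f v -> g v = iter k f u].
Proof.
move=> lf df nf; have lfk k := @linear_iter f k lf.
have [|||n1 h1] := df (fun n => range (iter n.+1 f)).
- by move=> n; apply: submod_image (submodT _); apply: linear_iter.
- by move=> n _ [x _ <-]; exists (f x); rewrite // -iterSr.
- by move=> _ [x _ <-]; exists x.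
pose D n : set M := range f `&` iter n f @^-1` [set 0].
have sD n : submod (D n).
  apply: submodI; first exact: submod_image (submodT _).
  by apply: submod_preimage (@submod0 _ _); apply: linear_iter.
have [||_ [_ [n2 ->] maxD]] := fg_max (P := fun B => exists n, B = D n).
- by exists (D 0%N); split=> //; exists 0%N.
- move=> C sC PC _ sU; apply: nf => // x [n _]; case: (PC n) => m -> [] //.
have hD m : (n2 <= m)%N -> D m = D n2.
  move=> hm; apply: maxD => //; first by exists m.
  move=> x [rx hx]; split=> //; rewrite /preimage /= -(subnK hm) iterD.
  by move: hx; rewrite /preimage /= => ->; rewrite (lin0 (lfk _)).
pose k := (maxn n1 n2).+1.
have imk v : exists u, iter k f (iter k f u) = iter k f v.
  have : range (iter (k + k).-1.+1 f) (iter k f v).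
    rewrite h1; last by rewrite /k addSn /= (leq_trans (leq_maxl n1 n2))// leq_addr.
    by rewrite -(h1 (maxn n1 n2)) ?leq_maxl//; exists v.
  by case=> u _ <-; exists u; rewrite -iterD.
have kerk v : iter k f (iter k f v) = 0 -> iter k f v = 0.
  rewrite -iterD {1}/k addSn iterSr => e.
  have : D (maxn n1 n2 + k)%N (f v) by split => //; exists v.
  rewrite hD; last by rewrite (leq_trans (leq_maxr n1 n2))// leq_addr.
  rewrite -(hD (maxn n1 n2)) ?leq_maxr// => -[_].
  by rewrite /preimage /= -iterSr.
have [g hg] := choice imk.
have uniq u v : iter k f (iter k f u) = iter k f v -> iter k f (g v) = iter k f u.
  move=> e; apply/eqP; rewrite -subr_eq0 -(linB _ _ (lfk k)); apply/eqP; apply: kerk.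
  by rewrite !(linB _ _ (lfk k)) hg e subrr.
exists k, (iter k f \o g); split=> // [a x y|v]; last first.
  by exists (g v) => //; apply: hg.
change (iter k f (g (a *: x + y)) = a *: iter k f (g x) + iter k f (g y)).
rewrite -(linZ _ _ (lfk k)) -(linD _ _ (lfk k)); apply: uniq.
by rewrite !(linD _ _ (lfk k)) !(linZ _ _ (lfk k)) !hg.
Qed.

End Endomorphisms.

(** * Graded artinian rings have bounded support *)

Lemma right_artinianP (R : pzRingType) : right_artinian R -> artinian R^c.
Proof.
move=> aR C sC dC _; apply: (aR C _ dC) => n; have [c0 cD cZ] := sC n.
split=> // [x y|x r Cx]; first exact: (submodB (sC n)).
exact: (cZ r).
Qed.

Section FiniteSupport.
Variable R : gradedRing.
Local Notation "r `_[ j ]" := (hcomp (gr_grading R) r j) (at level 3).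
Implicit Types (x r s : R) (d i j : int).

Lemma hcomp0 j : (0 : R)`_[j] = 0.
Proof.
have [G0 _] := (gr_grading R).1 j.
by rewrite (hcomp_hom _ G0); case: ifP.
Qed.

Lemma hcomp_eq0 s : (forall j, s`_[j] = 0) -> s = 0.
Proof.
move=> h; have [_ _ e] := hcompP (gr_grading R) s; rewrite e.
by rewrite (@fsumE _ _ [::]) ?big_nil.
Qed.

Lemma hcompMl x i s j : gr_comp i x -> (x * s)`_[j] = x * s`_[j - i].
Proof.
move=> hx; have [fs Gs es] := hcompP (gr_grading R) s.
have [A uA hA] := finsupp1 fs.
have h m : m \notin [seq i + n | n <- A] -> x * s`_[m - i] = 0.
  move=> hm; rewrite hA ?mulr0//; apply: contra hm => hm.
  by apply/mapP; exists (m - i) => //; rewrite addrCA subrr addr0.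
rewrite (@hcomp_uniq _ _ (gr_grading R) (x * s) (fun m => x * s`_[m - i]))//.
- exact: finsuppP h.
- by move=> m; rewrite -{1}(subrK i m) [m - i + i]addrC; apply: gr_mul.
- have ui : uniq [seq i + n | n <- A] by rewrite map_inj_uniq//; apply: addrI.
  rewrite (fsumE ui h) big_map {1}es (fsumE uA hA) mulr_sumr.
  by apply: eq_bigr => n _; rewrite [i + n]addrC addrK.
Qed.

Lemma eventually0 (W : zmodType) (f : int -> W) d j : d != 0 -> finite_set [set n | f n <> 0] ->
  exists k0 : nat, forall k : nat, (k0 <= k)%N -> f (j + d * k%:Z) = 0.
Proof.
move=> d0 /finsupp1[A _ hA]; have [b hb] : exists b : nat, forall a, a \in A -> (`|a| <= b)%N.
  elim: A {hA} => [|a A [b hb]]; first by exists 0%N.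
  exists (maxn `|a| b)%N => c; rewrite inE => /orP[/eqP->|/hb]; lia.
exists (b + `|j|).+1%N => k hk; apply: hA; apply/negP => /hb; nia.
Qed.

Lemma gr_comp1 : gr_comp 0 (1 : R).
Proof.
have [_ G _] := hcompP (gr_grading R) 1.
by move: (G 0); rewrite hcomp1 eqxx.
Qed.

Lemma linear_lmul x : linear (fun s : (R^c)^o => (x * (s : R) : R) : (R^c)^o).
Proof.
move=> a u v; rewrite /= [LHS]mulrDr; congr (_ + _).
exact: (@mulrA R x u a).
Qed.

Hypothesis artR : artinian R^c.

(** Left multiplication by 1 - x is injective, so the descending chain of the
    (1 - x)^n R makes 1 - x right invertible.  The homogeneous components of the
    inverse are the powers of x, and only finitely many are not zero. *)
Lemma homogeneous_nilpotent d x : d != 0 -> gr_comp d x -> exists k, x ^+ k = 0.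
Proof.
move=> d0 hx; set y := 1 - x.
(* Iteration gives s_j = x^k s_(j - d k), which vanishes for large k. *)
have fixed0 s j : (forall n : nat, s`_[j - d * n%:Z] = x * s`_[j - d * n.+1%:Z]) -> s`_[j] = 0.
  move=> e; have [fs _ _] := hcompP (gr_grading R) s.
  have [|k /(_ k (leqnn k)) hk] := @eventually0 R (hcomp (gr_grading R) s) (- d) j _ fs.
    by rewrite oppr_eq0.
  have : s`_[j] = x ^+ k * s`_[j - d * k%:Z].
    elim: k {hk} => [|k IH]; first by rewrite mulr0 subr0 expr0 mul1r.
    by rewrite IH e mulrA -exprSr.
  by move=> ->; rewrite -mulNr hk mulr0.
have yreg s : y * s = 0 -> s = 0.
  rewrite /y mulrBl mul1r => /eqP; rewrite subr_eq0 => /eqP e.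
  apply: hcomp_eq0 => j; apply: fixed0 => n.
  rewrite {1}e (hcompMl _ _ hx); congr (x * _ `_[ _ ]); lia.
have yXreg n s : y ^+ n * s = 0 -> s = 0.
  elim: n s => [|n IH] s; first by rewrite expr0 mul1r.
  by rewrite exprS -mulrA => /yreg /IH.
have [|||n /(_ n.+1 (leqnSn n)) hn] := artR (C := fun n => range (fun s : (R^c)^o => (y ^+ n * (s : R) : R) : (R^c)^o)).
- by move=> n; apply: submod_image (linear_lmul _) (@submodT _ _).
- by move=> n _ [s _ <-]; exists (y * (s : R)); rewrite // exprSr mulrA.
- by [].
have : range (fun s : (R^c)^o => (y ^+ n * (s : R) : R) : (R^c)^o) (y ^+ n).
  by exists 1; rewrite ?mulr1.
rewrite -hn => -[r0 _]; set r : R := r0; rewrite exprSr -mulrA => er.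
have {}er : r = 1 + x * r.
  apply/eqP; rewrite -subr_eq0 opprD addrA addrAC -{1}[r]mul1r -mulrBl; apply/eqP.
  by apply: (yXreg n); rewrite mulrBr er mulr1 subrr.
have rj j : r`_[j] = (if j == 0 then 1 else 0) + x * r`_[j - d].
  by rewrite {1}er hcompD hcomp1 (hcompMl _ _ hx).
have rneg : r`_[- d] = 0.
  apply: fixed0 => i; rewrite rj; have -> : (- d - d * i%:Z == 0) = false by nia.
  by rewrite add0r; congr (x * _ `_[ _ ]); lia.
have rX k : r`_[d * k%:Z] = x ^+ k.
  elim: k => [|k IH]; first by rewrite rj mulr0 eqxx sub0r rneg mulr0 addr0.
  rewrite rj; have -> : (d * k.+1%:Z == 0) = false by nia.
  by rewrite add0r exprS -IH; congr (x * _ `_[ _ ]); lia.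
have [fr _ _] := hcompP (gr_grading R) r.
have [k /(_ k (leqnn k))] := @eventually0 R (hcomp (gr_grading R) r) d 0 d0 fr.
by rewrite add0r rX => e; exists k.
Qed.

Lemma fg_regularT : fg [set: (R^c)^o].
Proof.
have -> : [set: (R^c)^o] = range (fun a : R^c => a *: (1 : (R^c)^o)); last exact: fg_line.
rewrite eqEsubset; split=> // x _; exists (x : R^c) => //; exact: mulr1.
Qed.

(** The right ideals X n generated by the components of degree e m with m >= n
    stabilise at a finitely generated X.  Comparing degrees in expressions by
    generators of bounded degree, X = S X for the semigroup S of left
    multiplications by homogeneous elements of degree e m with m > 0.  As S is
    nil, X = 0. *)
Lemma half_support e : e != 0 ->
  exists n0 : nat, forall m : nat, (n0 <= m)%N -> forall r, gr_comp (e * m%:Z) r -> r = 0.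
Proof.
move=> e0; pose H n : set (R^c)^o := [set r | exists2 m : nat, (n <= m)%N & gr_comp (e * m%:Z) (r : R)].
pose X n := lspan (H n).
have sX n : submod (X n) by apply: submod_lspan.
have HS n : H n.+1 `<=` H n by move=> r [m hm hr]; exists m => //; apply: ltnW.
have [||n1 h1] := artR sX.
- by move=> n; apply: lspanS.
- by [].
pose n0 := n1.+1.
have Xn0 m : (n0 <= m)%N -> X m = X n0.
  by move=> hm; rewrite (h1 m (ltnW hm)) (h1 n0 (leqnSn _)).
have dX : dcc (X n0) by apply: dccS artR _.
have nX : noeth (X n0).
  by move=> B sB _; apply: (artinian_fgS artR fg_regularT sB).
pose U D : set (R^c)^o := [set r | exists m : nat, [/\ (n0 <= m)%N, (m <= D)%N & gr_comp (e * m%:Z) (r : R)]].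
have US D D' : (D <= D')%N -> lspan (U D) `<=` lspan (U D').
  move=> hD; apply: lspanS => r [m [h h' hr]]; exists m; split=> //; exact: leq_trans hD.
have [D hD] : exists D, X n0 `<=` lspan (U D).
  have XU r : X n0 r -> exists D, lspan (U D) r.
    suff : X n0 `<=` [set r | exists D, lspan (U D) r] by apply.
    apply: lspan_min => {r} [|r [m hm hr]]; last first.
      by exists m; apply: sub_lspan; exists m.
    split; first by exists 0%N; case: (submod_lspan (U 0%N)).
      move=> x y [D hx] [D' hy]; exists (maxn D D').
      case: (submod_lspan (U (maxn D D'))) => _ hDD _; apply: hDD.
        by apply: US hx; apply: leq_maxl.
      by apply: US hy; apply: leq_maxr.
    by move=> a x [D hx]; exists D; case: (submod_lspan (U D)) => _ _; apply.
  have [s es] : fg (X n0) by apply: nX.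
  have : [set` s] `<=` X n0 by rewrite es; apply: sub_lspan.
  move=> hs; rewrite es; elim: s hs {es} => [|r s IH] hs.
    by exists 0%N; apply: lspan_min (submod_lspan _) _ => r.
  have [|D hD] := IH; first by move=> t /= ts; apply: hs; rewrite /= inE ts orbT.
  have [D' hD'] := XU r (hs r (mem_head _ _)).
  exists (maxn D D'); apply: lspan_min (submod_lspan _) _ => t /=; rewrite inE => /orP[/eqP->|ts].
    by apply: US hD'; apply: leq_maxr.
  by apply: US (hD _ (sub_lspan ts)); apply: leq_maxl.
pose S : set ((R^c)^o -> (R^c)^o) :=
  [set f | exists (m : nat) (a : R), [/\ (0 < m)%N, gr_comp (e * m%:Z) a & f = fun s => a * (s : R)]].
pose SX : set (R^c)^o := lspan [set y | exists (s : (R^c)^o -> (R^c)^o) (x : (R^c)^o), [/\ S s, X n0 x & y = s x]].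
have sSX : submod SX by apply: submod_lspan.
have XSX : X n0 `<=` SX.
  rewrite -(Xn0 (n0 + D)%N) ?leq_addr//; apply: lspan_min (sSX) _ => r [m hm hr].
  have Xr : X n0 r by apply: sub_lspan; exists m => //; apply: leq_trans hm; apply: leq_addr.
  pose T : set (R^c)^o := [set y | forall s : R, SX ((y : R) * s)`_[e * m%:Z]].
  have sT : submod T.
    have [S0 SD SZ] := sSX; split=> [s|x y hx hy s|a x hx s].
    - by rewrite mul0r hcomp0.
    - by rewrite mulrDl hcompD; apply: SD; [apply: hx|apply: hy].
    - by rewrite -[(a *: x : R) * s]/((x : R) * (a : R) * s) -mulrA; apply: hx.
  have UT : U D `<=` T.
    move=> a [i [h1i h2i ha]] s; rewrite (hcompMl _ _ ha).
    apply: sub_lspan; exists (fun t => (a : R) * (t : R)), (s`_[e * m%:Z - e * i%:Z]); split; last reflexivity.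
      by exists i, a; split; [exact: leq_ltn_trans h1i|exact: ha|reflexivity].
    apply: sub_lspan; exists (m - i)%N; first lia.
    have -> : e * (m - i)%N%:Z = e * m%:Z - e * i%:Z by rewrite -mulrBr subzn//; lia.
    by have [_ G _] := hcompP (gr_grading R) s; apply: G.
  have := lspan_min sT UT (hD _ Xr) 1; rewrite mulr1.
  by rewrite (hcomp_hom (gr_grading R) hr) eqxx.
exists n0 => m hm r hr.
suff : X n0 `<=` [set 0] by apply; apply: sub_lspan; exists m.
apply: nil_semigroup XSX => //.
- by move=> _ [i [a [_ _ ->]]]; apply: linear_lmul.
- move=> _ _ [i [a [i0 ha ->]]] [j [b [j0 hb ->]]]; exists (i + j)%N, (a * b); split=> //.
  + by rewrite addn_gt0 i0.
  + by rewrite PoszD mulrDr; apply: gr_mul.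
  + by apply/funext => s /=; rewrite mulrA.
- move=> _ x [i [a [i0 ha ->]]]; apply: (lspan_min (submod_preimage (linear_lmul a) (sX n0))).
  move=> b [j hj hb]; apply: sub_lspan; exists (i + j)%N; first by apply: leq_trans hj _; apply: leq_addl.
  by rewrite PoszD mulrDr; apply: gr_mul.
- move=> _ [i [a [i0 ha ->]]]; have [|k ak] := homogeneous_nilpotent _ ha; first by nia.
  exists k => x _; have -> : iter k (fun s : (R^c)^o => a * (s : R) : (R^c)^o) x = a ^+ k * (x : R).
    by elim: k {ak} => [|k IH] /=; rewrite ?expr0 ?mul1r// IH exprS mulrA.
  by rewrite ak mul0r.
Qed.

Theorem graded_artinian_bounded : exists b : nat, forall n : int, (b <= `|n|)%N ->
  forall r, gr_comp n r -> r = 0.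
Proof.
have [|p hp] := @half_support 1; first by [].
have [|q hq] := @half_support (-1); first by [].
exists (maxn p q) => -[m|m] /= hm r hr; first by apply: (hp m); rewrite ?mul1r//; lia.
by apply: (hq m.+1); rewrite ?mulN1r//; lia.
Qed.
End FiniteSupport.

(** * Gradings as coactions of the pull-up comonad *)

Section PullupMaps.
Variables (R : gradedRing) (N : lmodType R^c).
Notation V := (pullup_carrier N).
Notation sg := (@pullup_single R N).
Implicit Types (v w : V) (h : V -> V) (x y : N) (n m d : int) (r : R).

Lemma homogeneous_linear (M1 M2 : lmodType R^c) (f : M1 -> M2) :
  (forall x y : M1, f (x + y) = f x + f y) ->
  (forall j (r : R) (x : M1), gr_comp j r -> f (ract x r) = ract (f x) r) -> linear f.
Proof.
move=> fD fZ a x y; rewrite fD; congr (_ + _).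
have f0 : f 0 = 0 by apply: (addIr (f 0)); rewrite -fD !add0r.
have : forall r : R, f (ract x r) = ract (f x) r; last by apply.
apply: (grading_ind (gr_grading R)) => [|r s hr hs|j r hr]; last exact: fZ hr.
  by rewrite /ract !scale0r.
by rewrite /ract !scalerDl fD -/(ract x r) -/(ract x s) hr hs.
Qed.

Lemma singleE n x m : sg n x m = if m == n then x else 0.
Proof. by []. Qed.

Lemma single_eq n x : sg n x n = x.
Proof. by rewrite singleE eqxx. Qed.

Lemma single0 n : sg n 0 = 0.
Proof. by apply: dsumP => m; rewrite singleE; case: ifP. Qed.

Lemma singleD n x y : sg n (x + y) = sg n x + sg n y.
Proof. by apply: dsumP => m; rewrite dsumDE !singleE; case: ifP; rewrite ?addr0. Qed.

Lemma single_sum n (J : Type) (s : seq J) (F : J -> N) :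
  sg n (\sum_(i <- s) F i) = \sum_(i <- s) sg n (F i).
Proof. by apply: (big_morph (sg n)); [exact: singleD | exact: single0]. Qed.

Lemma pullup_ractE v r j m : gr_comp j r -> (ract v r) m = ract (v (m - j)) r.
Proof. by move=> hr; rewrite [LHS](pullup_act_hom _ hr). Qed.

Lemma single_ract n x r j : gr_comp j r -> ract (sg n x) r = sg (n + j) (ract x r).
Proof.
move=> hr; apply: dsumP => m; rewrite (pullup_ractE _ _ hr) !singleE subr_eq.
by case: ifP => // _; rewrite ract0l.
Qed.

Lemma single_homog v n : (forall m, m != n -> v m = 0) -> v = sg n (v n).
Proof.
move=> h; apply: dsumP => m; rewrite singleE; case: eqP => [->//|/eqP]; exact: h.
Qed.

Lemma pullup_decomp v (A : seq int) : uniq A -> (forall n, n \notin A -> v n = 0) ->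
  v = \sum_(n <- A) sg n (v n).
Proof.
move=> uA hA; apply: dsumP => m; rewrite dsum_sumE.
have [mA|mA] := boolP (m \in A); last first.
  rewrite hA// big1_seq// => n /= nA; case: eqP => // e.
  by rewrite -e hA // e.
rewrite (bigD1_seq m)//= eqxx big1 ?addr0// => n nm.
by rewrite eq_sym (negbTE nm).
Qed.

Lemma pullup_supp v : exists2 A : seq int, uniq A & forall n, n \notin A -> v n = 0.
Proof. exact: finsupp1 (dsum_fin v). Qed.

Lemma pullup_ind (P : V -> Prop) : P 0 -> (forall v w, P v -> P w -> P (v + w)) ->
  (forall n x, P (sg n x)) -> forall v, P v.
Proof.
move=> P0 PD Ps v; have [A uA hA] := pullup_supp v.
by rewrite (pullup_decomp uA hA); elim/big_ind: _ => // n _; apply: Ps.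
Qed.

(** Homogeneity of degree d, tested on the homogeneous elements x e_n. *)
Definition hdeg d h := forall n x m, m != n + d -> h (sg n x) m = 0.

Lemma hdegE d h v m : linear h -> hdeg d h -> h v m = h (sg (m - d) (v (m - d))) m.
Proof.
move=> lh dh; move: v; apply: pullup_ind => [|v w hv hw|n x].
- by rewrite single0.
- by rewrite linD// !dsumDE hv hw singleD linD.
- rewrite singleE; case: eqP => [->//|/eqP ne]; rewrite single0 lin0// dh//.
  by rewrite -subr_eq.
Qed.

Lemma hdeg_single d h n x : hdeg d h -> h (sg n x) = sg (n + d) (h (sg n x) (n + d)).
Proof. by move=> dh; apply: single_homog => m; apply: dh. Qed.

Lemma hdeg_comp d d' h h' : hdeg d h -> hdeg d' h' -> hdeg (d' + d) (h \o h').
Proof.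
move=> dh dh' n x m hm /=; rewrite (hdeg_single _ _ dh') dh//.
by rewrite -addrA.
Qed.

Lemma hdeg0_comp h h' : hdeg 0 h -> hdeg 0 h' -> hdeg 0 (h \o h').
Proof. by move=> dh dh'; rewrite -[0](addr0 0); apply: hdeg_comp. Qed.

Lemma hdeg_id : hdeg 0 id.
Proof. by move=> n x m; rewrite addr0 singleE => /negbTE ->. Qed.

Lemma hdeg_iter d h k : hdeg d h -> hdeg (d * k%:Z) (iter k h).
Proof.
move=> dh; elim: k => [|k IH]; first by rewrite mulr0; apply: hdeg_id.
have -> : d * k.+1%:Z = d * k%:Z + d by lia.
exact: hdeg_comp dh IH.
Qed.

Lemma shift_fin d v : finite_set [set m | v (m - d) <> 0].
Proof.
have [A _ hA] := pullup_supp v.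
apply: (@finsuppP _ _ [seq n + d | n <- A]) => m hm; apply: hA.
by apply: contra hm => hm; apply/mapP; exists (m - d); rewrite ?subrK.
Qed.
Definition shift d v : V := DSum (shift_fin d v).

Lemma linear_shift d : linear (shift d).
Proof.
apply: homogeneous_linear => [v w|j r v hr]; first by apply: dsumP.
apply: dsumP => m; rewrite (pullup_ractE _ _ hr).
change ((ract v r) (m - d) = ract (v (m - j - d)) r).
by rewrite (pullup_ractE _ _ hr) addrAC.
Qed.

Lemma hdeg_shift d : hdeg d (shift d).
Proof.
by move=> n x m; change (m != n + d -> sg n x (m - d) = 0); rewrite singleE subr_eq => /negbTE ->.
Qed.

Lemma pullup_map_fin (e : N -> N) v : linear e -> finite_set [set m | e (v m) <> 0].
Proof.
move=> le; have [A _ hA] := pullup_supp v.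
by apply: (@finsuppP _ _ A) => m /hA ->; rewrite lin0.
Qed.
Definition pullup_map (e : N -> N) (le : linear e) v : V := DSum (pullup_map_fin v le).

Lemma linear_pullup_map (e : N -> N) (le : linear e) : linear (pullup_map le).
Proof.
apply: homogeneous_linear => [v w|j r v hr]; apply: dsumP => m.
  exact: (linD _ _ le).
rewrite (pullup_ractE _ _ hr); change (e ((ract v r) m) = ract (e (v (m - j))) r).
by rewrite (pullup_ractE _ _ hr) (linZ _ _ le).
Qed.

Lemma pullup_map_single (e : N -> N) (le : linear e) n x : pullup_map le (sg n x) = sg n (e x).
Proof.
by apply: dsumP => m; change (e (sg n x m) = sg n (e x) m); rewrite !singleE; case: ifP; rewrite ?lin0.
Qed.

Lemma hdeg_pullup_map (e : N -> N) (le : linear e) : hdeg 0 (pullup_map le).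
Proof. by move=> n x m; rewrite addr0 pullup_map_single singleE => /negbTE ->. Qed.

(** The counit q p N -> N of the adjunction between q and its right adjoint p. *)
Definition counit v : N := \sum_(n \in [set: int]) v n.

Lemma counitE v (A : seq int) : uniq A -> (forall n, n \notin A -> v n = 0) ->
  counit v = \sum_(n <- A) v n.
Proof. by move=> uA hA; apply: fsumE. Qed.

Lemma counit_single n x : counit (sg n x) = x.
Proof.
rewrite (@counitE _ [:: n])// ?big_seq1 ?single_eq// => m.
by rewrite inE singleE => /negbTE ->.
Qed.

Lemma linear_counit : linear counit.
Proof.
have cD v w : counit (v + w) = counit v + counit w.
  have [A uA [hv hw]] := finsupp2 (dsum_fin v) (dsum_fin w).
  rewrite (counitE uA hv) (counitE uA hw) (@counitE _ A)//; last first.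
    by move=> n nA; rewrite dsumDE hv// hw// addr0.
  by rewrite -big_split.
apply: homogeneous_linear => // j r v hr; move: v.
apply: pullup_ind => [|v w hv hw|n x].
- by rewrite /ract scaler0 /counit (@fsumE _ _ [::])// big_nil scaler0.
- by rewrite ractDl !cD hv hw ractDl.
- by rewrite (single_ract _ _ hr) !counit_single.
Qed.

End PullupMaps.

Arguments hdegE {R N d h} v m.
Arguments pullup_map {R N e}.

Section Gradable.
Variables (R : gradedRing) (N : lmodType R^c).
Notation V := (pullup_carrier N).
Notation sg := (@pullup_single R N).

(** A grading of N is the same thing as a coaction tau of the comonad q p: the
    second hypothesis is coassociativity, the third the counit law, and the
    component of degree n consists of the x with tau x = x e_n. *)
Lemma gradable_coaction (tau : N -> V) : linear tau ->
  (forall x n, tau (tau x n) = sg n (tau x n)) -> (forall x, counit (tau x) = x) ->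
  gradable N.
Proof.
move=> lt tt ct; pose G n : set N := [set x | tau x = sg n x].
have hG : is_grading G.
  split=> [n|x].
    split; first by rewrite /G /= single0 lin0.
    move=> x y; rewrite /G /= => hx hy; rewrite linB// hx hy.
    by apply: dsumP => m; rewrite dsumDE dsumNE !singleE; case: ifP; rewrite ?subr0.
  exists (tau x); split.
    split; [exact: dsum_fin|exact: tt|by rewrite -[LHS]ct].
  move=> f [ff hf ex]; apply/funext => m.
  have [A uA hA] := finsupp1 ff.
  have F : finite_set [set n | f n <> 0] by [].
  suff -> : tau x = DSum F by [].
  rewrite ex (fsumE uA hA) lin_sum//.
  rewrite (pullup_decomp (v := DSum F : V) uA hA).
  by apply: eq_bigr => n _; rewrite [LHS]hf.
have hact i j (x : N) (r : R) : G i x -> gr_comp j r -> G (i + j) (ract x r).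
  by rewrite /G /= => hx hr; rewrite [LHS](linZ _ _ lt) hx; apply: single_ract.
exists (@GradedMod R N G hG hact), (idfun : {linear N -> N}); exact: (Bijective (g := id)).
Qed.

Hypothesis artR : artinian R^c.

(** The degrees that occur in A are sums of a degree of a generator and a degree
    of R, and both are bounded. *)
Lemma fg_bounded (A : set V) : fg A ->
  exists b : nat, forall v n, A v -> (b <= `|n|)%N -> v n = 0.
Proof.
have [c hc] := graded_artinian_bounded artR.
case=> s ->; elim: s => [|w s [b hb]].
  exists 0%N => v n hv _; have /(_ v hv) -> // : lspan [set` [::] : seq V] `<=` [set 0].
  by apply: lspan_min (@submod0 _ _) _ => x.
have [B _ hB] := pullup_supp w.
have [a ha] : exists a : nat, forall n, n \in B -> (`|n| <= a)%N.
  elim: B {hB} => [|n B [a ha]]; first by exists 0%N.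
  exists (maxn `|n| a)%N => k; rewrite inE => /orP[/eqP->|/ha]; lia.
exists (maxn b (a + c).+1) => v n; rewrite lspan_cons => -[x [_ [sx [r _ <-] ->]]] hn.
rewrite dsumDE hb ?add0r//; last by lia.
suff h (t : R) : (a + c < `|n|)%N -> (ract w t) n = 0 by apply: h; lia.
move=> {}hn; move: t; apply: (grading_ind (gr_grading R)).
- by rewrite /ract scale0r.
- by move=> t u ht hu; rewrite ractD dsumDE -/(ract w t) ht hu addr0.
- move=> j t ht; rewrite (pullup_ractE _ _ ht).
  have [hj|hj] := leqP c `|j|; first by rewrite (hc _ hj _ ht) ract0.
  rewrite hB ?ract0l//; apply/negP => /ha; lia.
Qed.

End Gradable.

(** * Splitting off graded summands *)

Section GradedFitting.
Variables (R : gradedRing) (N : lmodType R^c).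
Hypothesis artR : artinian R^c.
Notation V := (pullup_carrier N).
Notation sg := (@pullup_single R N).
Implicit Types (v w : V) (h g : V -> V) (x y : N) (n m d : int).

Lemma submod_range h : linear h -> submod (range h).
Proof. by move=> lh; apply: submod_image lh (@submodT _ _). Qed.

Lemma dcc_range h (A : set V) : linear h -> fg A -> range h `<=` A -> dcc (range h).
Proof. by move=> lh fA hA; apply: dccS hA; apply: dcc_fg. Qed.

Lemma fg_range h (A : set V) : linear h -> fg A -> range h `<=` A -> fg (range h).
Proof. by move=> lh fA hA; apply: (artinian_fgS artR fA) hA; apply: submod_range. Qed.

(** Cutting the preimage that defines a value of the Fitting projection down to
    one degree leaves a preimage of the same kind, as h has degree 0. *)
Lemma graded_fitting h (A : set V) : linear h -> hdeg 0 h -> fg A -> range h `<=` A ->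
  exists k g, [/\ (0 < k)%N, linear g, hdeg 0 g &
    [/\ forall v, exists u, g v = iter k h u, forall u, g (iter k h u) = iter k h u
    & forall v, iter k h v = 0 -> g v = 0]].
Proof.
move=> lh dh fA hA.
have [|k [g [k0 lg P1 P2]]] := fitting lh (dcc_range lh fA hA).
  by move=> B sB hB; apply: (artinian_fgS artR fA sB); apply: subset_trans hB hA.
have lk := linear_iter k lh.
have dk : hdeg 0 (iter k h) by rewrite -[0](mul0r k%:Z); apply: hdeg_iter.
exists k, g; split=> //; last first.
  split=> [v|u|v e]; first by have [u] := P1 v; exists u.
    exact: P2.
  rewrite (P2 0) ?lin0//; by rewrite (lin0 lk) e.
move=> n x m; rewrite addr0 => mn.
have [u gu hu] := P1 (sg n x).
have dkk : hdeg 0 (iter k h \o iter k h) by apply: hdeg0_comp.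
have lkk : linear (iter k h \o iter k h) by apply: linear_comp.
rewrite (P2 (sg n (u n))); first by rewrite dk// addr0.
rewrite -hu gu; apply: dsumP => l; rewrite [RHS](hdegE u l lkk dkk) subr0 /=.
have [->//|ln] := eqVneq l n.
have -> : iter k h (iter k h (sg n (u n))) l = 0 by apply: (dkk n); rewrite addr0.
have := hdegE u l lkk dkk; rewrite /= subr0 => <-.
by rewrite -gu hu dk// addr0.
Qed.

End GradedFitting.

Section Splitting.
Variables (R : gradedRing) (N : lmodType R^c).
Hypothesis artR : artinian R^c.
Notation V := (pullup_carrier N).
Notation sg := (@pullup_single R N).
Implicit Types (v w : V) (h g : V -> V) (x y : N) (n m d : int).

Variables (e : N -> N) (le : linear e).
Local Notation pe := (pullup_map le).

(** A projection of p N onto a graded direct summand of p (e N) is encoded as an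
    endomorphism of p N compatible with p e, the idempotent map [pe]. *)
Definition graded_projection g :=
  [/\ linear g, hdeg 0 g, forall v, g (g v) = g v &
   (forall v, pe (g v) = g v) /\ (forall v, g (pe v) = g v)].

(** These are the projections onto the graded-indecomposable finitely generated
    summands of p (e N). *)
Definition minimal_projection g :=
  [/\ graded_projection g, fg (range g), exists v, g v <> 0 &
   forall g', graded_projection g' -> (exists v, g' v <> 0) ->
     range g' `<=` range g -> range g' = range g].

Hypothesis ee : forall x, e (e x) = e x.

Lemma pullup_mapK v : pe (pe v) = pe v.
Proof. by apply: dsumP => m; apply: ee. Qed.

Lemma fitting_projection h (A : set V) : linear h -> hdeg 0 h -> fg A -> range h `<=` A ->
  (forall v, pe (h v) = h v) -> (forall v, h (pe v) = h v) ->
  exists k g, [/\ graded_projection g, range g `<=` range h &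
    forall u, g (iter k h u) = iter k h u].
Proof.
move=> lh dh fA hA peh hpe; have [k [g [k0 lg dg [P1 P2 P3]]]] := graded_fitting artR lh dh fA hA.
have lk := linear_iter k lh.
exists k, g; split=> //; last first.
  by move=> _ [v _ <-]; have [u ->] := P1 v; case: k k0 {lk P1 P2 P3} => // k _; exists (iter k h u).
split=> // [v|]; first by have [u ->] := P1 v; rewrite P2.
split=> v.
  by have [u ->] := P1 v; case: k k0 {lk P1 P2 P3} => // k _ /=; rewrite peh.
apply/eqP; rewrite -subr_eq0 -(linB _ _ lg); apply/eqP; apply: P3.
case: k k0 {lk P1 P2} => // k _; rewrite iterSr (linB _ _ lh) hpe subrr.
by rewrite (lin0 (linear_iter k lh)).
Qed.

(** The compression of h by p e fixes x e_0, so its Fitting projection is not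
    zero; the descending chain condition below its image does the rest. *)
Lemma minimal_projection_exists h (A : set V) x : linear h -> hdeg 0 h -> fg A ->
  range h `<=` A -> h (sg 0 x) = sg 0 x -> e x = x -> x <> 0 ->
  exists g, minimal_projection g.
Proof.
move=> lh dh fA hA hx ex x0.
pose h1 := pe \o h \o pe.
have lpe := linear_pullup_map le.
have lh1 : linear h1 by apply: linear_comp => //; apply: linear_comp.
have dh1 : hdeg 0 h1.
  have dpe := hdeg_pullup_map le.
  by do 2?apply: hdeg0_comp.
have fA1 : fg (pe @` A) by apply: fg_image.
have h1A : range h1 `<=` pe @` A.
  by move=> _ [v _ <-]; exists (h (pe v)) => //; apply: hA; exists (pe v).
have [||k [g [pg rg gk]]] := fitting_projection lh1 dh1 fA1 h1A.
- by move=> v; rewrite /h1 /= pullup_mapK.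
- by move=> v; rewrite /h1 /= pullup_mapK.
have h1x : h1 (sg 0 x) = sg 0 x by rewrite /h1 /= pullup_map_single ex hx pullup_map_single ex.
have gx : g (sg 0 x) = sg 0 x.
  by have := gk (sg 0 x); have -> : iter k h1 (sg 0 x) = sg 0 x by elim: k {gk} => //= k ->.
have [lg _ _ _] := pg.
have fg0 : fg (range g) by apply: (fg_range artR lg fA1); apply: subset_trans rg h1A.
have [|B [_ Bg [g1 [pg1 nz1 eB]] min1]] :=
    dcc_min (P := fun B => exists g, [/\ graded_projection g, exists v, g v <> 0 & B = range g])
    (dcc_fg artR fg0).
  exists (range g); split=> //; first exact: submod_range.
  exists g; split=> //; exists (sg 0 x); rewrite gx => /(congr1 (fun v : V => v 0)).
  by rewrite single_eq.
subst B; have [lg1 _ _ _] := pg1.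
exists g1; split=> //; first exact: (fg_range artR lg1 fg0).
move=> g2 pg2 nz2 h21; apply: min1 => //.
  by case: pg2 => lg2 _ _ _; apply: submod_range.
by exists g2.
Qed.

Section Split.
Variables (g : V -> V) (ming : minimal_projection g).

Let pg : graded_projection g. Proof. by case: ming. Qed.
Let lg : linear g. Proof. by case: pg. Qed.
Let dg : hdeg 0 g. Proof. by case: pg. Qed.
Let gg v : g (g v) = g v. Proof. by case: pg. Qed.
Let peg v : pe (g v) = g v. Proof. by case: pg => _ _ _ []. Qed.
Let gpe v : g (pe v) = g v. Proof. by case: pg => _ _ _ []. Qed.
Let fgG : fg (range g). Proof. by case: ming. Qed.
Let sG : submod (range g). Proof. exact: submod_range. Qed.

Lemma range_fixed v : range g v -> g v = v.
Proof. by case=> w _ <-. Qed.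

Lemma projection_single v n : g v = v -> g (sg n (v n)) = sg n (v n).
Proof.
move=> gv; rewrite (hdeg_single _ _ dg) addr0; congr (sg n _).
by rewrite -[in RHS]gv (hdegE v n lg dg) subr0.
Qed.

(** By Fitting's lemma and minimality of the projection, an endomorphism of
    degree 0 of its image is nilpotent or surjective. *)
Lemma degree0_nilpotent_or_surjective h : linear h -> hdeg 0 h -> (forall v, g (h v) = h v) ->
  (exists k, forall v, g v = v -> iter k h v = 0) \/
  (forall v, g v = v -> exists2 w, g w = w & h w = v).
Proof.
move=> lh dh gh; pose h1 := h \o g.
have lh1 : linear h1 by apply: linear_comp.
have dh1 : hdeg 0 h1 by apply: hdeg0_comp.
have h1G : range h1 `<=` range g by move=> _ [v _ <-]; exists (h (g v)) => //; apply: gh.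
have hh1 k v : g v = v -> iter k h1 v = iter k h v /\ g (iter k h v) = iter k h v.
  by move=> gv; elim: k => //= k [-> ek]; rewrite /h1 /= ek gh.
have [||k [g' [pg' rg' gk]]] := fitting_projection lh1 dh1 fgG h1G.
- by move=> v; rewrite /h1 /= -gh peg.
- by move=> v; rewrite /h1 /= gpe.
have [[v0 nz]|z] := pselect (exists v, g' v <> 0); [right|left].
  have [_ _ _ /(_ g' pg' (ex_intro _ v0 nz)) e'] := ming.
  move=> v gv; have : range g' v by rewrite e'; [exists v|apply: subset_trans rg' h1G].
  by move=> /rg'[w _ <-]; exists (g w).
exists k => v gv; have [<- _] := hh1 k v gv; rewrite -gk.
by apply: contrapT => nz; apply: z; exists (iter k h1 v).
Qed.

(** The powers of h move the bounded support of the image of g out of itself. *)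
Lemma nonzero_degree_nilpotent h d : d != 0 -> linear h -> hdeg d h -> (forall v, g (h v) = h v) ->
  exists k, forall v, g v = v -> iter k h v = 0.
Proof.
move=> d0 lh dh gh; have [b hb] := fg_bounded artR fgG.
(* Two degrees of absolute value below b differ by less than 2 b. *)
exists (2 * b).+1 => v gv; apply: dsumP => m.
have lk := linear_iter (2 * b).+1 lh; have dk := hdeg_iter (k := (2 * b).+1) dh.
have [hm|hm] := leqP b `|m|.
  by rewrite hb//; exists (iter (2 * b) h (h v)); rewrite // -iterSr /= gh.
rewrite (hdegE v m lk dk) (hb v); first by rewrite single0 (lin0 lk).
  by exists v.
nia.
Qed.

Definition nil_endo h := [/\ linear h, exists d, hdeg d h, forall v, g (h v) = h v &
  exists k, forall v, g v = v -> iter k h v = 0].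

(** Only h o h' of degree 0 is at stake.  Were it not nilpotent, it would be
    surjective on the image of g, hence so would h, although h is nilpotent. *)
Lemma nil_endo_comp h h' : nil_endo h -> nil_endo h' -> nil_endo (h \o h').
Proof.
move=> [lh [d dh] gh [k nk]] [lh' [d' dh'] gh' _].
have lhh : linear (h \o h') by apply: linear_comp.
have dhh : hdeg (d' + d) (h \o h') by apply: hdeg_comp.
have ghh v : g ((h \o h') v) = (h \o h') v by rewrite /= gh.
split=> //; first by exists (d' + d).
have [d0|d0] := eqVneq (d' + d) 0; last exact: nonzero_degree_nilpotent dhh _.
rewrite d0 in dhh; have [//|sur] := degree0_nilpotent_or_surjective lhh dhh ghh.
(* The image of g is then zero, so that the power 0 already vanishes on it. *)
exists 0%N => v gv.
have [w gw <-] : exists2 w, g w = w & iter k h w = v.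
  elim: k v gv {nk} => [|k IH] v gv; first by exists v.
  have [w gw ew] := sur v gv; have [u gu eu] := IH _ (gh' w).
  by exists u; rewrite //= eu.
exact: nk.
Qed.

Lemma coadjoint_fin x : finite_set [set m | g (sg m x) m <> 0].
Proof.
have [b hb] := fg_bounded artR fgG.
apply: (@finsuppP _ _ [seq (i : nat)%:Z - b%:Z | i <- iota 0 (2 * b)]) => m hm.
have [h|h] := leqP b `|m|; first by apply: hb => //; exists (sg m x).
case/negP: hm; apply/mapP; exists (absz (m + b%:Z)); last by lia.
by rewrite mem_iota; lia.
Qed.
(** The map N -> q G, with G the image of g, that sends x to the sum of the
    g (x e_n).  The sum is finite because G has bounded support; this makes p also
    a left adjoint of q as far as maps to G are concerned. *)
Definition coadjoint x : V := DSum (coadjoint_fin x).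

Lemma coadjointE x m : coadjoint x m = g (sg m x) m. Proof. by []. Qed.

Lemma linear_coadjoint : linear coadjoint.
Proof.
apply: homogeneous_linear => [x y|j r x hr]; apply: dsumP => m.
  by rewrite dsumDE !coadjointE singleD (linD _ _ lg).
rewrite (pullup_ractE _ _ hr) !coadjointE -{1}(subrK j m) -(single_ract _ _ hr).
have -> : g (ract (sg (m - j) x) r) = ract (g (sg (m - j) x)) r by apply: linZ.
by rewrite (pullup_ractE _ _ hr).
Qed.

Lemma coadjoint_range x : g (coadjoint x) = coadjoint x.
Proof.
apply: dsumP => m; rewrite (hdegE _ m lg dg) subr0 coadjointE.
by rewrite -{2}(gg (sg m x)) [g (sg m x) in RHS](hdeg_single _ _ dg) addr0.
Qed.

Local Notation f := (coadjoint \o @counit R N).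

(** The decomposition of f on the image of g into its homogeneous parts: the part
    of degree d is g o shift d. *)
Lemma coadjoint_counit_sum : exists2 D : seq int, uniq D /\ 0 \in D &
  forall v, g v = v -> f v = \sum_(d <- D) g (shift d v).
Proof.
have [b hb] := fg_bounded artR fgG.
(* D contains all differences of two degrees of absolute value below b. *)
pose D := [seq (i : nat)%:Z - (2 * b)%:Z | i <- iota 0 (4 * b).+1].
have hD d : (`|d| <= 2 * b)%N -> d \in D.
  by move=> hd; apply/mapP; exists (absz (d + (2 * b)%:Z)); [rewrite mem_iota; lia|lia].
exists D; first by split; [rewrite map_inj_uniq ?iota_uniq// => i j; lia|apply: hD].
move=> v gv; apply: dsumP => m; rewrite dsum_sumE [LHS]coadjointE.
have rg w : range g (g w) by exists w.
have [hm|hm] := leqP b `|m|.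
  by rewrite hb// big1// => d _; apply: hb.
have ui : uniq [seq m - d | d <- D].
  rewrite map_inj_uniq; first by rewrite map_inj_uniq ?iota_uniq// => i j; lia.
  by move=> i j; lia.
rewrite (counitE ui); last first.
  move=> n nD; apply: (hb v); first by exists v.
  rewrite leqNgt; apply: contra nD => nb; apply/mapP; exists (m - n); last by lia.
  by apply: hD; lia.
rewrite big_map single_sum (lin_sum _ _ lg) dsum_sumE; apply: eq_bigr => d _.
by rewrite [RHS](hdegE _ m lg dg) subr0.
Qed.

(** The degree 0 part of f is the identity of G and its parts g o shift d with
    d <> 0 are nilpotent.  So if f x = 0 then x is in the span of its images under
    nilpotent maps, and the submodule generated by x and all its images under
    nilpotent homogeneous maps vanishes by [nil_semigroup]. *)
Lemma coadjoint_counit_injective (x : V) : g x = x -> f x = 0 -> x = 0.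
Proof.
have [D [uD D0] eD] := coadjoint_counit_sum => gx.
rewrite eD// (bigD1_seq 0)//= => ex.
have sh0 : shift 0 x = x by apply: dsumP => m; change (x (m - 0) = x m); rewrite subr0.
rewrite sh0 gx in ex.
pose X : set V := lspan [set y | y = x \/ exists2 s, nil_endo s & y = s x].
have sX : submod X by apply: submod_lspan.
have XG : X `<=` range g.
  apply: lspan_min sG _ => _ [->|[s [_ _ gs _] ->]]; first by exists x.
  by exists (s x).
have Xx : X x by apply: sub_lspan; left.
suff : X `<=` [set 0] by apply.
apply: (@nil_semigroup _ _ X nil_endo) => //.
- by apply: dccS XG; apply: dcc_fg.
- by move=> B sB BX; apply: (artinian_fgS artR fgG sB); apply: subset_trans BX XG.
- by move=> s [].
- exact: nil_endo_comp.
- move=> s y ns; have [ls _ _ _] := ns; move: y.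
  apply: (lspan_min (submod_preimage ls sX)) => _ [->|[t nt ->]]; apply: sub_lspan; right.
    by exists s.
  by exists (s \o t) => //; apply: nil_endo_comp.
- by move=> s [_ _ _ [k nk]]; exists k => y /XG[z _ <-]; apply: nk.
set SX := lspan _; have sSX : submod SX by apply: submod_lspan.
have xSX : SX x.
  have -> : x = - \sum_(d <- D | d != 0) g (shift d x).
    by apply/eqP; rewrite -addr_eq0 ex.
  rewrite -scaleN1r; case: (sSX) => _ _; apply.
  rewrite -big_filter; apply: submod_sum => // d; rewrite mem_filter => /andP[d0 _].
  have lgs : linear (g \o @shift R N d) by apply: linear_comp lg (@linear_shift _ _ d).
  have dgs : hdeg d (g \o @shift R N d).
    by rewrite -[d in hdeg d _]addr0; apply: hdeg_comp dg (@hdeg_shift _ _ d).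
  apply: sub_lspan; exists (g \o @shift R N d), x; split=> //; split=> //.
  - by exists d.
  - by move=> v; rewrite /= gg.
  - by apply: nonzero_degree_nilpotent dgs _ => // v; rewrite /= gg.
apply: lspan_min (sSX) _ => _ [->//|[s ns ->]].
by apply: sub_lspan; exists s, x.
Qed.

(** As f is bijective on G, the counit embeds q G as a direct summand of N, with
    retraction kappa, the inverse of f after the coadjoint map. *)
Lemma split_summand : exists kappa : N -> V,
  [/\ linear kappa, forall x n, e (kappa x n) = kappa x n, forall x, kappa (e x) = kappa x,
      forall x n, kappa (kappa x n) = sg n (kappa x n) & exists x n, kappa x n <> 0].
Proof.
have lf : linear f by apply: linear_comp linear_coadjoint (@linear_counit _ _).
have fG v : range g v -> range g (f v).
  by move=> _; exists (f v) => //; rewrite /= coadjoint_range.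
have inj v : range g v -> f v = 0 -> v = 0.
  by move=> /range_fixed; apply: coadjoint_counit_injective.
have surf := injective_dcc_surjective (dcc_fg artR fgG) sG lf fG inj.
have ex x : exists w, g w = w /\ f w = coadjoint x.
  have [|_ [w _ <-] fw] := surf (coadjoint x).
    by exists (coadjoint x); rewrite ?coadjoint_range.
  by exists (g w); rewrite gg.
have [kappa hk] := choice ex.
have uniq v w : g v = v -> g w = w -> f v = f w -> v = w.
  move=> gv gw fvw; apply/eqP; rewrite -subr_eq0; apply/eqP.
  apply: coadjoint_counit_injective; first by rewrite (linB _ _ lg) gv gw.
  by rewrite (linB _ _ lf) fvw subrr.
have kc v : g v = v -> kappa (counit v) = v.
  by move=> gv; have [gk fk] := hk (counit v); apply: uniq.
exists kappa; split.
- move=> a x y; have [gx fx] := hk x; have [gy fy] := hk y; have [gxy fxy] := hk (a *: x + y).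
  apply: uniq => //; first by rewrite (linD _ _ lg) (linZ _ _ lg) gx gy.
  by rewrite (linD _ _ lf) (linZ _ _ lf) fx fy fxy linear_coadjoint.
- move=> x n; have [gx _] := hk x.
  by have := peg (kappa x); rewrite gx => /(congr1 (fun v : V => v n)).
- move=> x; have [gx fx] := hk x; have [gy fy] := hk (e x); apply: uniq => //.
  rewrite fx fy; apply: dsumP => m; rewrite !coadjointE.
  by rewrite -(pullup_map_single le) gpe.
- move=> x n; have [gx _] := hk x.
  by rewrite -[X in kappa X](counit_single n) kc// projection_single.
have [_ _ [v nz] _] := ming.
exists (counit (g v)); apply: contrapT => h; apply: nz; apply: dsumP => n.
by apply: contrapT => hn; apply: h; exists n; rewrite kc.
Qed.

End Split.
End Splitting.

Section Gradability.
Variables (R : gradedRing) (N : lmodType R^c).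
Hypothesis artR : artinian R^c.
Notation V := (pullup_carrier N).
Notation sg := (@pullup_single R N).

(** It suffices that p N is locally a retract of finitely generated graded
    modules.  Keep a coaction tau of a graded direct summand of N and split off
    a further graded summand as long as the complement, the image of the
    idempotent 1 - counit o tau, is not zero; the coactions then add up. *)
Theorem gradable_of_local_retracts : fg [set: N] ->
  (forall x : N, exists (u : V -> V) (A : set V),
     [/\ linear u, hdeg 0 u, fg A, range u `<=` A & u (sg 0 x) = sg 0 x]) ->
  gradable N.
Proof.
move=> fgN W.
pose partial (tau : N -> V) := linear tau /\ forall x n, tau (tau x n) = sg n (tau x n).
pose e (tau : N -> V) x := x - counit (tau x).
have lin_e tau : partial tau -> linear (e tau).
  move=> [lt _] a x y; rewrite /e lt (@linear_counit R N) scalerBr.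
  by rewrite opprD addrACA.
have tauc tau x : partial tau -> tau (counit (tau x)) = tau x.
  move=> [lt tt]; have [A uA hA] := pullup_supp (tau x).
  rewrite (counitE uA hA) lin_sum// [RHS](pullup_decomp uA hA).
  by apply: eq_bigr => n _.
have ee tau x : partial tau -> e tau (e tau x) = e tau x.
  move=> pt; rewrite {1}/e; have [lt _] := pt.
  by rewrite /e (linB _ _ lt) tauc// subrr (lin0 (@linear_counit R N)) subr0.
have taue tau x : partial tau -> tau (e tau x) = 0.
  by move=> pt; have [lt _] := pt; rewrite /e (linB _ _ lt) tauc// subrr.
have etau tau x n : partial tau -> e tau (tau x n) = 0.
  by move=> [_ tt]; rewrite /e tt counit_single subrr.
have [|_ [_ _ [tau [pt ->]] mint]] :=
    dcc_min (P := fun B => exists tau, partial tau /\ B = range (e tau)) (dcc_fg artR fgN).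
  have p0 : partial (fun=> 0).
    by split=> [a x y|x n]; rewrite ?single0// scaler0 addr0.
  exists (range (e (fun=> 0))); split=> //; last by exists (fun=> 0).
  by apply: submod_image (@submodT _ _); apply: lin_e.
have lt : linear tau by case: pt.
have [[x0 nz]|z] := pselect (exists x, e tau x <> 0); last first.
  apply: (gradable_coaction lt); first by case: pt.
  move=> x; apply/eqP; rewrite eq_sym -subr_eq0; apply/eqP.
  by apply: contrapT => h; apply: z; exists x.
pose x := e tau x0; have ex : e tau x = x by apply: ee.
have [u [A [lu du fA uA ux]]] := W x.
have eet y : e tau (e tau y) = e tau y by apply: ee.
have [g ming] := minimal_projection_exists artR (lin_e _ pt) eet lu du fA uA ux ex nz.
have [k [lk ek ke kk [y [n nzk]]]] := split_summand artR ming.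
pose tau' x := tau x + k x.
have tk y' n' : tau (k y' n') = 0 by rewrite -ek taue.
have kt y' n' : k (tau y' n') = 0 by rewrite -ke etau// lin0.
have pt' : partial tau'.
  have [_ tt] := pt.
  split=> [a v w|v i]; first by rewrite /tau' lt lk scalerDr addrACA.
  rewrite /tau' !dsumDE singleD (linD _ _ lt) (linD _ _ lk) tk kt tt kk.
  by rewrite addr0 add0r.
have ck v : e tau (counit (k v)) = counit (k v).
  have [B uB hB] := pullup_supp (k v).
  by rewrite (counitE uB hB) (lin_sum _ _ (lin_e _ pt)); apply: eq_bigr => i _; apply: ek.
have eet' v : e tau' v = e tau (v - counit (k v)).
  have tc : tau (counit (k v)) = 0 by rewrite -ck taue.
  rewrite {2}/e (linB _ _ lt) tc subr0 /e /tau' (linD _ _ (@linear_counit R N)).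
  by rewrite opprD addrA addrAC.
have rg' : range (e tau') = range (e tau).
  apply: mint.
  - by apply: submod_image (@submodT _ _); exact: (lin_e _ pt').
  - by exists tau'.
  - by move=> _ [v _ <-]; rewrite eet'; exists (v - counit (k v)).
case: nzk.
have : range (e tau) (k y n) by exists (k y n); rewrite ?ek.
rewrite -rg' => -[z _ ez]; rewrite -ez -(ee _ _ pt') ez.
by rewrite /e /tau' tk add0r kk counit_single subrr.
Qed.
End Gradability.

(** * Local retracts of the pull-up *)

Section FinitePresentation.
Variables (R : pzRingType).

Lemma fg_finitely_generated (M : lmodType R^c) : finitely_generated M -> fg [set: M].
Proof.
case=> n [x hx]; exists [seq x i | i <- enum 'I_n]; rewrite eqEsubset; split=> // y _.
have [a ->] := hx y; apply: submod_sum; first exact: submod_lspan.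
move=> i _; case: (submod_lspan [set` [seq x i | i <- enum 'I_n]]) => _ _; apply.
by apply: sub_lspan; apply: map_f; rewrite mem_enum.
Qed.

Definition lincomb (M : lmodType R^c) (s : seq M) (v : 'rV[R^c]_(size s)) : M :=
  \sum_i v 0 i *: s`_i.
Arguments lincomb {M} s v.

Lemma linear_lincomb (M : lmodType R^c) (s : seq M) : linear (lincomb s).
Proof.
move=> a u v; rewrite /lincomb scaler_sumr -big_split; apply: eq_bigr => i _ /=.
by rewrite !mxE scalerDl scalerA.
Qed.

Lemma lincomb_delta (M : lmodType R^c) (s : seq M) i : lincomb s (delta_mx 0 i) = s`_i.
Proof.
rewrite /lincomb (bigD1 i)//= mxE !eqxx scale1r big1 ?addr0// => j ji.
by rewrite mxE (negbTE ji) andbF scale0r.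
Qed.

Lemma range_lincomb (M : lmodType R^c) (s : seq M) : range (lincomb s) = lspan [set` s].
Proof.
rewrite eqEsubset; split.
  move=> _ [v _ <-]; apply: submod_sum; first exact: submod_lspan.
  move=> i _; case: (submod_lspan [set` s]) => _ _; apply.
  by apply: sub_lspan; apply: mem_nth.
apply: lspan_min; first by apply: submod_image (@submodT _ _); apply: linear_lincomb.
move=> x /= xs; have hi : (index x s < size s)%N by rewrite index_mem.
by exists (delta_mx 0 (Ordinal hi)) => //; rewrite lincomb_delta /= nth_index.
Qed.

Lemma fg_row n : fg [set: 'rV[R^c]_n].
Proof.
exists [seq delta_mx 0 i | i <- enum 'I_n]; rewrite eqEsubset; split=> // v _.
rewrite (row_sum_delta v); apply: submod_sum; first exact: submod_lspan.
move=> i _; case: (submod_lspan [set` [seq delta_mx 0 i : 'rV[R^c]_n | i <- enum 'I_n]]) => _ _; apply.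
by apply: sub_lspan; apply: map_f; rewrite mem_enum.
Qed.

Lemma fg_finitely_presented (M : lmodType R^c) : finitely_presented M -> fg [set: M].
Proof.
case=> k [n [f [g [<- _]]]]; apply: fg_image (@fg_row n).
exact: (@linearP _ _ _ _ g).
Qed.

Lemma finitely_presented_artinian (M : lmodType R^c) :
  artinian R^c -> fg [set: M] -> finitely_presented M.
Proof.
move=> aR [s es]; have lg := @linear_lincomb M s.
have [t et] : fg (lincomb s @^-1` [set 0]).
  by apply: (artinian_fgS aR (@fg_row (size s))) => //; apply: submod_preimage (@submod0 _ _).
have [f ef] := linear_bundle (@linear_lincomb _ t).
have [g eg] := linear_bundle lg.
by exists (size t), (size s), f, g; rewrite ef eg et !range_lincomb es.
Qed.

End FinitePresentation.

Lemma linear_inverse (K : pzRingType) (M1 M2 : lmodType K) (f : M1 -> M2) (g : M2 -> M1) :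
  linear f -> cancel f g -> cancel g f -> linear g.
Proof. by move=> lf fK gK a x y; apply: (can_inj fK); rewrite lf !gK. Qed.

Section SmallEndomorphisms.
Variables (R : gradedRing) (N : lmodType R^c).
Notation V := (pullup_carrier N).
Notation sg := (@pullup_single R N).

(** Over an artinian ring these are the endomorphisms of p N of degree 0 that
    factor through a finitely generated graded module. *)
Definition small (u : V -> V) :=
  [/\ linear u, hdeg 0 u & exists A, fg A /\ range u `<=` A].

Lemma small_sum (J : Type) (s : seq J) (u : J -> V -> V) :
  (forall j, small (u j)) -> small (fun v => \sum_(j <- s) u j v).
Proof.
move=> su; elim: s => [|j s [ls ds [A [fA hA]]]].
  split=> [a x y|n x m _|]; rewrite ?big_nil ?scaler0 ?addr0//.
  by exists [set 0]; split; [exact: fg0|move=> _ [v _ <-]; rewrite big_nil].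
have [lj dj [B [fB hB]]] := su j.
split=> [a x y|n x m mn|].
- by rewrite !big_cons lj ls scalerDr addrACA.
- by rewrite big_cons dsumDE dj// add0r ds.
- exists (addm B A); split; first exact: fg_addm.
  move=> _ [v _ <-]; rewrite big_cons; exists (u j v), (\sum_(j <- s) u j v); split=> //.
    by apply: hB; exists v.
  by apply: hA; exists v.
Qed.

End SmallEndomorphisms.

Section PureProjective.
Variables (R : gradedRing) (N : lmodType R^c).
Notation V := (pullup_carrier N).
Notation sg := (@pullup_single R N).

(** The components of x other than the one of degree n are sent to components of
    f x that vanish. *)
Lemma gm_comp_of_injective (M1 M2 : gradedMod R) (f : forget M1 -> forget M2) n x : linear f ->
  injective f -> (forall n x, gm_comp n x -> gm_comp n (f x)) -> gm_comp n (f x) -> gm_comp n x.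
Proof.
move=> lf injf gf fx; have [fin G ex] := hcompP (gm_grading M1) x.
have [A uA hA] := finsupp1 fin.
have hA' m : m \notin A -> f (hcomp (gm_grading M1) x m) = 0 by move=> /hA ->; rewrite lin0.
have e : hcomp (gm_grading M2) (f x) = fun m => f (hcomp (gm_grading M1) x m).
  apply: hcomp_uniq; first exact: finsuppP hA'.
    by move=> m; apply: gf.
  by rewrite {1}ex (fsumE uA hA) (fsumE uA hA') lin_sum.
have z m : m != n -> hcomp (gm_grading M1) x m = 0.
  move=> mn; apply: injf; rewrite lin0// -[LHS]/((fun m => f (hcomp (gm_grading M1) x m)) m) -e.
  by rewrite (hcomp_hom _ fx) (negbTE mn).
have hz m : m \notin [:: n] -> hcomp (gm_grading M1) x m = 0 by rewrite inE => /z.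
by rewrite ex (fsumE _ hz)// big_seq1; apply: G.
Qed.

Section Components.
Variables (I : Type) (F : I -> lmodType R^c).

Definition dsum_inj_val i (x : F i) (j : I) : F j :=
  match pselect (i = j) with left e => eq_rect i (fun j => F j) x j e | right _ => 0 end.

Lemma dsum_inj_fin i (x : F i) : finite_set [set j | dsum_inj_val x j <> 0].
Proof.
apply: (@sub_finite_set _ _ [set i]); last exact: finite_set1.
by move=> j /=; rewrite /dsum_inj_val; case: pselect.
Qed.
Definition dsum_inj i (x : F i) : direct_sum F := DSum (dsum_inj_fin x).

Lemma linear_dsum_inj i : linear (@dsum_inj i).
Proof.
move=> a x y; apply: dsumP => j.
change (dsum_inj_val (a *: x + y) j = a *: dsum_inj_val x j + dsum_inj_val y j).
rewrite /dsum_inj_val; case: pselect => [e|_]; last by rewrite scaler0 addr0.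
by case: _ / e.
Qed.

Lemma dsum_inj_sum (d : direct_sum F) (s : seq {classic I}) : uniq s ->
  (forall i : I, ~ (i : {classic I}) \in s -> (d : dsum _) i = 0) ->
  d = \sum_(i <- s) dsum_inj ((d : dsum _) i).
Proof.
move=> us hs; apply: dsumP => j; rewrite dsum_sumE.
have e i : dsum_val (dsum_inj ((d : dsum _) i)) j = if (i : {classic I}) == j then (d : dsum _) j else 0.
  rewrite /= /dsum_inj_val; case: pselect => [e|ne].
    by case: _ / e; rewrite eqxx.
  by case: eqP.
rewrite (eq_bigr _ (fun i _ => e i)); have [js|js] := boolP ((j : {classic I}) \in s).
  by rewrite (bigD1_seq (j : {classic I}))//= eqxx big1 ?addr0// => i /negbTE ->.
rewrite hs; last exact/negP.
by rewrite big1 => [|i _]; last case: ifP.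
Qed.
End Components.

(** The inclusion of p N in a direct sum sends x e_0 to an element with finitely
    many coordinates; the sum of the projections to these coordinates, followed
    by the retraction to p N, fixes x e_0. *)
Lemma graded_pure_projective_retracts : graded_pure_projective (pullup N) ->
  forall x : N, exists u : V -> V, small u /\ u (sg 0 x) = sg 0 x.
Proof.
move=> [I [F [C [fpF [f [[finv fK finvK] gf]]]]]] x.
have lf : linear f by exact: (@linearP _ _ _ _ f).
have lfinv := linear_inverse lf fK finvK.
pose d0 := finv (sg 0 x, 0).
have /(@finite_seqP {classic I})[s0 es0] : finite_set [set i : {classic I} | (d0 : dsum _) i <> 0].
  exact: dsum_fin.
pose s := undup s0.
pose u (i : {classic I}) (v : V) : V := (f (dsum_inj ((finv (v, 0) : dsum _) (i : I)))).1.
exists (fun v => \sum_(i <- s) u i v); split; last first.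
  have e0 : (f d0).1 = sg 0 x by rewrite finvK.
  have hs (i : I) : ~ (i : {classic I}) \in s -> (d0 : dsum _) i = 0.
    move=> h; apply: contrapT => hi; apply: h; rewrite mem_undup.
    by have : [set` s0] (i : {classic I}) by rewrite -es0.
  rewrite -[RHS]e0 [in RHS](dsum_inj_sum (undup_uniq s0) hs) (lin_sum _ _ lf).
  by rewrite (big_morph (fun x : _ * _ => x.1) (id1 := 0) (op1 := +%R)).
apply: small_sum => i; split.
- move=> a v w; rewrite /u.
  have -> : (a *: v + w, 0) = a *: ((v, 0) : (forget (pullup N) * forget C)%type) + (w, 0).
    by congr pair; rewrite /= scaler0 addr0.
  by rewrite lfinv; rewrite (linear_dsum_inj a) lf.
- move=> n y m; rewrite addr0 => mn; rewrite /u.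
  have hd : gdsum_comp n (finv (sg n y, 0)).
    apply: (@gm_comp_of_injective (graded_direct_sum F) (graded_prod (pullup N) C) f n _ lf (can_inj fK) gf).
    rewrite finvK; split; last by case: ((gm_grading C).1 n).
    by move=> k /= /negbTE ->.
  have hi : gdsum_comp n (dsum_inj ((finv (sg n y, 0) : dsum _) (i : I))).
    move=> j /=; rewrite /dsum_inj_val; case: pselect => [e|_].
      by case: _ / e; apply: hd.
    by case: ((gm_grading (F j)).1 n).
  by have [h _] := gf n _ hi; apply: h.
- pose h (y : forget (F i)) : V := (f (dsum_inj y)).1.
  have lh : linear h by move=> a y z; rewrite /h (linear_dsum_inj a) lf.
  exists (h @` setT); split.
    by apply: fg_image => //; apply: fg_finitely_presented; apply: fpF.
  by move=> _ [v _ <-]; exists ((finv (v, 0) : dsum _) (i : I)).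
Qed.

(** Since p q V is the direct sum of the shifts of V = p N, p phi and p psi are
    maps from V to this direct sum and back.  At the shift by n their coordinates
    send y e_m to the component of degree m + n of phi(y), respectively
    w e_(m + n) to psi(w e_(m + n)) e_m. *)
Section SplitMap.
Variables (phi : N -> V) (psi : V -> N) (lphi : linear phi) (lpsi : linear psi).

Lemma component_push_fin n (v : V) : finite_set [set k | phi (v (k - n)) k <> 0].
Proof.
have [A _ hA] := pullup_supp v.
apply: (@finsuppP _ _ [seq m + n | m <- A]) => k hk; rewrite hA ?lin0//.
by apply: contra hk => hk; apply/mapP; exists (k - n); rewrite ?subrK.
Qed.
Definition component_push n (v : V) : V := DSum (component_push_fin n v).

Lemma component_pull_fin n (w : V) : finite_set [set m | psi (sg (m + n) (w (m + n))) <> 0].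
Proof.
have [A _ hA] := pullup_supp w.
apply: (@finsuppP _ _ [seq k - n | k <- A]) => m hm; rewrite hA ?single0 ?lin0//.
by apply: contra hm => hm; apply/mapP; exists (m + n); rewrite ?addrK.
Qed.
Definition component_pull n (w : V) : V := DSum (component_pull_fin n w).

Lemma linear_component_push n : linear (component_push n).
Proof.
apply: homogeneous_linear => [v w|j r v hr]; apply: dsumP => k.
  change (phi (v (k - n) + w (k - n)) k = phi (v (k - n)) k + phi (w (k - n)) k).
  by rewrite linD.
rewrite (pullup_ractE _ _ hr).
change (phi ((ract v r) (k - n)) k = ract (phi (v (k - j - n)) (k - j)) r).
rewrite (pullup_ractE _ _ hr) addrAC -(pullup_ractE _ _ hr).
by rewrite [phi (ract _ _)](linZ _ _ lphi).
Qed.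

Lemma linear_component_pull n : linear (component_pull n).
Proof.
apply: homogeneous_linear => [v w|j r w hr]; apply: dsumP => m.
  change (psi (sg (m + n) (v (m + n) + w (m + n))) =
    psi (sg (m + n) (v (m + n))) + psi (sg (m + n) (w (m + n)))).
  by rewrite singleD linD.
rewrite (pullup_ractE _ _ hr).
change (psi (sg (m + n) ((ract w r) (m + n))) = ract (psi (sg (m - j + n) (w (m - j + n)))) r).
rewrite (pullup_ractE _ _ hr) -[RHS](linZ _ _ lpsi) [X in _ = psi X](single_ract _ _ hr).
by rewrite [m - j + n]addrAC subrK.
Qed.

(** The image lies in the submodule generated by the homogeneous components of
    the phi(x), for x in a finite generating set of N: this submodule is graded,
    so it contains the components of phi(y) for all y in N. *)
Lemma component_push_range n : fg [set: N] -> exists A, fg A /\ range (component_push n) `<=` A.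
Proof.
case=> s es.
have [X hX] : exists X : seq V, forall x, x \in s -> forall k, lspan [set` X] (sg k (phi x k)).
  elim: s {es} => [|x s [X hX]]; first by exists [::].
  have [A _ hA] := pullup_supp (phi x).
  exists ([seq sg k (phi x k) | k <- A] ++ X) => y; rewrite inE => /orP[/eqP->|ys] k.
    have [kA|kA] := boolP (k \in A).
      by apply: sub_lspan; rewrite /= mem_cat; apply/orP; left; apply/mapP; exists k.
    by rewrite hA// single0; case: (submod_lspan [set` [seq sg k (phi x k) | k <- A] ++ X]).
  by apply: lspanS (hX y ys k) => z /= zX; rewrite mem_cat zX orbT.
pose P := lspan [set` X]; have sP : submod P by apply: submod_lspan.
have [P0 PD PZ] := sP.
pose Q : set V := [set w | forall k, P (sg k (w k))].
have sQ : submod Q.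
  split=> [k|v w hv hw k|a w hw]; first by rewrite single0.
    by rewrite dsumDE singleD; apply: PD.
  suff : forall r : R, Q (ract w r) by apply.
  apply: (grading_ind (gr_grading R)) => [k|r t hr ht k|j r hr k].
  - by rewrite /ract scale0r single0.
  - by rewrite ractD dsumDE singleD; apply: PD.
  - rewrite (pullup_ractE _ _ hr) -{1}(subrK j k) -(single_ract _ _ hr).
    exact: PZ.
have Qphi y : Q (phi y).
  have : [set: N] `<=` phi @^-1` Q; last by apply.
  rewrite es; apply: lspan_min (submod_preimage lphi sQ) _ => x /= xs k; exact: hX.
exists P; split; first exact: fg_lspan.
move=> _ [v _ <-]; move: v; apply: pullup_ind => [|v w hv hw|m y].
- by rewrite lin0//; apply: linear_component_push.
- by rewrite (linD _ _ (linear_component_push n)); apply: PD.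
have -> : component_push n (sg m y) = sg (m + n) (phi y (m + n)); last exact: Qphi.
apply: dsumP => k; change (phi (sg m y (k - n)) k = sg (m + n) (phi y (m + n)) k).
rewrite !singleE subr_eq; case: eqP => [->//|_]; by rewrite lin0.
Qed.

Lemma component_small n : fg [set: N] -> small (component_pull n \o component_push n).
Proof.
move=> fN; have [A [fA hA]] := component_push_range n fN.
split.
- exact: linear_comp (linear_component_pull n) (linear_component_push n).
- move=> m x k; rewrite addr0 => km.
  change (psi (sg (k + n) (phi (sg m x (k + n - n)) (k + n))) = 0).
  by rewrite addrK singleE (negbTE km) (lin0 lphi) single0 lin0.
- exists (component_pull n @` A); split; first exact: fg_image (linear_component_pull n) fA.
  by move=> _ [v _ <-]; exists (component_push n v) => //; apply: hA; exists v.
Qed.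

(** The composites of the coordinates sum to the identity on x e_0, since psi(phi x)
    is the sum of the psi of the components of phi(x). *)
Lemma small_retracts_of_split : fg [set: N] -> (forall x, psi (phi x) = x) ->
  forall x : N, exists u : V -> V, small u /\ u (sg 0 x) = sg 0 x.
Proof.
move=> fN pp x; have [A uA hA] := pullup_supp (phi x).
exists (fun v => \sum_(n <- A) (component_pull n \o component_push n) v); split.
  by apply: small_sum => n; apply: component_small.
rewrite -{2}(pp x) (pullup_decomp uA hA) (lin_sum _ _ lpsi) single_sum.
apply: eq_bigr => n _; apply: dsumP => k.
change (psi (sg (k + n) (phi (sg 0 x (k + n - n)) (k + n))) = sg 0 (psi (sg n (phi x n))) k).
rewrite addrK !singleE; case: eqP => [->|_]; first by rewrite add0r.
by rewrite (lin0 lphi) single0 lin0.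
Qed.

End SplitMap.

End PureProjective.

(** * The pull-up of a gradable module *)

Section Coaction.
Variables (R : gradedRing) (N : lmodType R^c).
Notation V := (pullup_carrier N).
Notation sg := (@pullup_single R N).

Lemma hcomp_ract (M : gradedMod R) (x : forget M) j (r : R) n : gr_comp j r ->
  hcomp (gm_grading M) (ract x r) n = ract (hcomp (gm_grading M) x (n - j)) r.
Proof.
move=> hr; have [fx Gx ex] := hcompP (gm_grading M) x.
have [A uA hA] := finsupp1 fx.
have h m : m \notin [seq i + j | i <- A] -> ract (hcomp (gm_grading M) x (m - j)) r = 0.
  move=> hm; rewrite hA ?ract0l//; apply: contra hm => hm.
  by apply/mapP; exists (m - j) => //; rewrite subrK.
have ui : uniq [seq i + j | i <- A] by rewrite map_inj_uniq//; apply: addIr.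
rewrite (@hcomp_uniq _ _ (gm_grading M) _ (fun m => ract (hcomp (gm_grading M) x (m - j)) r))//.
- exact: finsuppP h.
- by move=> m; rewrite -{1}(subrK j m); apply: gm_act.
- rewrite (fsumE ui h) big_map {1}ex (fsumE uA hA) /ract scaler_sumr.
  by apply: eq_bigr => i _; rewrite addrK.
Qed.

Lemma coaction_of_gradable : gradable N -> exists tau : N -> V,
  [/\ linear tau, forall x n, tau (tau x n) = sg n (tau x n) & forall x, counit (tau x) = x].
Proof.
move=> [M [th [th' thK th'K]]]; pose hM := gm_grading M.
have lth : linear th by exact: (@linearP _ _ _ _ th).
have lth' := linear_inverse lth thK th'K.
have fin x : finite_set [set n | th' (hcomp hM (th x) n) <> 0].
  have [fx _ _] := hcompP hM (th x); have [A _ hA] := finsupp1 fx.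
  by apply: (@finsuppP _ _ A) => n /hA ->; rewrite lin0.
exists (fun x => DSum (fin x)); split.
- apply: homogeneous_linear => [x y|j r x hr]; apply: dsumP => n.
    rewrite dsumDE; change (th' (hcomp hM (th (x + y)) n) =
      th' (hcomp hM (th x) n) + th' (hcomp hM (th y) n)).
    by rewrite (linD _ _ lth) hcompD (linD _ _ lth').
  rewrite (pullup_ractE _ _ hr); change (th' (hcomp hM (th (ract x r)) n) =
    ract (th' (hcomp hM (th x) (n - j))) r).
  rewrite [th (ract x r)](linZ _ _ lth) [hcomp _ _ _](hcomp_ract _ _ hr).
  exact: (linZ _ _ lth').
- move=> x n; apply: dsumP => m.
  change (th' (hcomp hM (th (th' (hcomp hM (th x) n))) m) =
    if m == n then th' (hcomp hM (th x) n) else 0).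
  have [_ G _] := hcompP hM (th x).
  by rewrite th'K (hcomp_hom hM (G n)); case: ifP => // _; rewrite lin0.
- move=> x; have [fx _ ex] := hcompP hM (th x); have [A uA hA] := finsupp1 fx.
  rewrite (@counitE _ _ _ A)//; last first.
    by move=> n nA; change (th' (hcomp hM (th x) n) = 0); rewrite hA// lin0.
  by rewrite -[RHS]thK [X in _ = _ X]ex (fsumE uA hA) (lin_sum _ _ lth').
Qed.

Variable tau : N -> V.
Hypotheses (lt : linear tau) (tt : forall x n, tau (tau x n) = sg n (tau x n))
  (ct : forall x, counit (tau x) = x).

Definition shifted_comp (k n : int) : set N := [set x | tau x = sg (n + k) x].

Lemma shifted_grading k : is_grading (shifted_comp k).
Proof.
split=> [n|x].
  split; first by rewrite /shifted_comp /= single0 lin0.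
  move=> x y; rewrite /shifted_comp /= => hx hy; rewrite linB// hx hy.
  by apply: dsumP => m; rewrite dsumDE dsumNE !singleE; case: ifP; rewrite ?subr0.
have [A uA hA] := pullup_supp (tau x).
have ui : uniq [seq n - k | n <- A] by rewrite map_inj_uniq//; apply: addIr.
have h n : n \notin [seq n - k | n <- A] -> tau x (n + k) = 0.
  move=> hn; apply: hA; apply: contra hn => hn.
  by apply/mapP; exists (n + k); rewrite ?addrK.
exists (fun n => tau x (n + k)); split.
  split; [exact: finsuppP h|by move=> n; rewrite /shifted_comp /= tt|].
  rewrite (fsumE ui h) big_map -{1}(ct x) (counitE uA hA).
  by apply: eq_bigr => n _; rewrite subrK.
move=> f [ff hf ex]; apply/funext => m.
have [B uB hB] := finsupp1 ff.
rewrite ex (fsumE uB hB) lin_sum// dsum_sumE.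
rewrite (eq_bigr (fun n => (sg (n + k) (f n)) (m + k))); last by move=> n _; rewrite hf.
have [mB|mB] := boolP (m \in B).
  rewrite (bigD1_seq m)//= eqxx big1 ?addr0// => n nm.
  by rewrite (inj_eq (addIr k)) eq_sym (negbTE nm).
rewrite hB// big1_seq// => n /= nB; rewrite (inj_eq (addIr k)); case: eqP => // e.
by rewrite e nB in mB.
Qed.

Lemma shifted_act k i j (x : N) (r : R) : shifted_comp k i x -> gr_comp j r ->
  shifted_comp k (i + j) (ract x r).
Proof.
rewrite /shifted_comp /= => hx hr; rewrite [LHS](linZ _ _ lt) hx.
by rewrite [LHS](single_ract _ _ hr) addrAC.
Qed.

Definition shifted k : gradedMod R := @GradedMod R N _ (shifted_grading k) (@shifted_act k).

Local Notation D := (direct_sum (fun _ : int => N)).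

(** The map from the direct sum of all shifts of N to p N that embeds the k-th
    copy of N by the coaction shifted by -k: a homogeneous x of degree m goes to
    x e_(m - k).  As families indexed by the integers, the two sides have the same
    elements, and with this identification the map is its own inverse: it
    replaces the index k of such an x by m - k. *)
Definition unshift (d : D) : V :=
  \sum_(k \in [set: int]) shift (- k) (tau ((d : dsum _) k)).

Lemma unshiftE (d : D) (A : seq int) : uniq A -> (forall k, k \notin A -> (d : dsum _) k = 0) ->
  unshift d = \sum_(k <- A) shift (- k) (tau ((d : dsum _) k)).
Proof.
move=> uA hA; apply: fsumE => // k /hA ->.
by rewrite (lin0 lt) (lin0 (@linear_shift R N _)).
Qed.

Lemma linear_unshift : linear (unshift : D -> V).
Proof.
move=> a x y; have [A uA [hx hy]] := finsupp2 (dsum_fin x) (dsum_fin y).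
rewrite (unshiftE uA hx) (unshiftE uA hy) (@unshiftE _ A)//; last first.
  move=> k kA; change (a *: (x : dsum _) k + (y : dsum _) k = 0).
  by rewrite hx// hy// scaler0 addr0.
rewrite scaler_sumr -big_split; apply: eq_bigr => k _.
change (shift (- k) (tau (a *: (x : dsum _) k + (y : dsum _) k)) =
  a *: shift (- k) (tau ((x : dsum _) k)) + shift (- k) (tau ((y : dsum _) k))).
by rewrite lt (@linear_shift R N).
Qed.

Lemma unshift_single l x : unshift (sg l x) = shift (- l) (tau x).
Proof.
rewrite (@unshiftE _ [:: l])//; last by move=> k; rewrite inE singleE => /negbTE ->.
by rewrite big_seq1 single_eq.
Qed.

Lemma unshiftK (v : V) : unshift (unshift v : D) = v.
Proof.
move: v; apply: pullup_ind => [|v w hv hw|l x].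
- rewrite [X in unshift X](_ : _ = 0); first exact: (lin0 linear_unshift).
  exact: (lin0 linear_unshift).
- rewrite [X in unshift X](_ : _ = (unshift v : D) + (unshift w : D)).
    by rewrite (linD _ _ linear_unshift) hv hw.
  exact: (linD _ _ linear_unshift).
rewrite unshift_single; have [A uA hA] := pullup_supp (tau x).
have ui : uniq [seq n - l | n <- A] by rewrite map_inj_uniq//; apply: addIr.
have e k : (shift (- l) (tau x)) k = tau x (k + l) by rewrite /= opprK.
rewrite (unshiftE ui); last first.
  move=> k hk; rewrite e; apply: hA; apply: contra hk => hk.
  by apply/mapP; exists (k + l); rewrite ?addrK.
rewrite big_map -{2}(ct x) (counitE uA hA) single_sum; apply: eq_bigr => n _.
rewrite e subrK tt; apply: dsumP => m.
change (sg n (tau x n) (m - - (n - l)) = sg l (tau x n) m).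
by rewrite !singleE; have -> : (m - - (n - l) == n) = (m == l) by lia.
Qed.

Lemma unshift_graded n (d : D) : gdsum_comp (M := shifted) n d -> pullup_comp n (unshift d).
Proof.
move=> hd m mn; have [A uA hA] := finsupp1 (dsum_fin d).
rewrite (unshiftE uA hA) dsum_sumE big1// => k _.
have -> : tau ((d : dsum _) k) = sg (n + k) ((d : dsum _) k) by apply: hd.
change (sg (n + k) ((d : dsum _) k) (m - - k) = 0).
by rewrite singleE opprK (inj_eq (addIr k)) (negbTE mn).
Qed.

End Coaction.

Section ZeroModule.
Variable R : gradedRing.

Lemma zero_grading : is_grading (fun _ : int => [set: 'rV[R^c]_0]).
Proof.
split=> // x; exists (fun=> 0); split; last by move=> f _; apply/funext => n; rewrite !thinmx0.
split=> //; last by rewrite thinmx0 [RHS]thinmx0.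
by apply: (@finsuppP _ _ [::]).
Qed.

Definition zero_module : gradedMod R :=
  @GradedMod R 'rV[R^c]_0 _ zero_grading (fun _ _ _ _ _ _ => I).
End ZeroModule.

Section Reindex.
Variables (K : pzRingType) (N : lmodType K).

Lemma reindex_fin (I J : choiceType) (g : J -> I) (g' : I -> J) (d : dsum (fun _ : I => N)) :
  cancel g g' -> finite_set [set j | d (g j) <> 0].
Proof.
move=> gK; have /finite_seqP[s es] := dsum_fin d.
apply: (@sub_finite_set _ _ [set` map g' s]); last exact: finite_seq.
move=> j /= hj; apply/mapP; exists (g j); last by rewrite gK.
by have : [set` s] (g j) by rewrite -es.
Qed.

Lemma direct_sum_reindex (I J : choiceType) (g : J -> I) (g' : I -> J) :
  cancel g g' -> cancel g' g ->
  exists h : direct_sum (fun _ : I => N) -> direct_sum (fun _ : J => N),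
    linear h /\ bijective h.
Proof.
move=> gK g'K; exists (fun d => DSum (reindex_fin d gK)); split.
  by move=> a x y; apply: dsumP.
exists (fun d => DSum (reindex_fin d g'K)) => d; apply: dsumP => i.
  by change (dsum_val d (g (g' i)) = dsum_val d i); rewrite g'K.
by change (dsum_val d (g' (g i)) = dsum_val d i); rewrite gK.
Qed.
End Reindex.

Definition int_of_nat (n : nat) : int := if odd n then Negz n./2 else Posz n./2.
Definition nat_of_int (k : int) : nat := match k with Posz n => n.*2 | Negz n => n.*2.+1 end.

Lemma int_of_natK : cancel int_of_nat nat_of_int.
Proof.
move=> n; rewrite /int_of_nat -[RHS]odd_double_half; case: odd => //=.
Qed.

Lemma nat_of_intK : cancel nat_of_int int_of_nat.
Proof.
case=> n; rewrite /int_of_nat /= odd_double /= ?doubleK//.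
by rewrite uphalf_double.
Qed.

Theorem theorem1p2 (R : gradedRing) (N : lmodType R^c)
    (artR : right_artinian R) (fgN : finitely_generated N) :
  (gradable N <-> graded_pure_projective (pullup N)) /\
  (gradable N <-> mod_iso (forget (pullup N)) (countable_copower N)).
Proof.
have aR := right_artinianP artR; have fN := fg_finitely_generated fgN.
have W : (forall x : N, exists u : pullup_carrier N -> pullup_carrier N,
    small u /\ u (pullup_single 0 x) = pullup_single 0 x) -> gradable N.
  move=> h; apply: gradable_of_local_retracts => // x.
  by have [u [[lu du [A [fA uA]]] ux]] := h x; exists u, A.
split; split=> [/coaction_of_gradable[tau [lt tt ct]]|].
- pose T := unshift tau.
  have lT : linear (T : direct_sum (fun _ : int => N) -> pullup_carrier N) by apply: linear_unshift.
  exists int, (shifted lt tt ct), (zero_module R); split.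
    by move=> k; apply: finitely_presented_artinian.
  pose f0 (d : direct_sum (fun _ : int => N)) : pullup_carrier N * 'rV[R^c]_0 := (T d, 0).
  have lf0 : linear f0 by move=> a x y; rewrite /f0 lT; congr pair; rewrite /= scaler0 addr0.
  have [f ef] := linear_bundle lf0.
  exists f; split.
    exists (fun p => T p.1) => [d|[v z]]; rewrite ef /f0 /=; first exact: unshiftK.
    by rewrite [z]thinmx0; congr pair; apply: unshiftK.
  move=> n d hd; rewrite ef; split=> //; apply: unshift_graded hd.
- by move=> h; apply: W => x; apply: graded_pure_projective_retracts.
- pose T := unshift tau.
  have lT : linear (T : direct_sum (fun _ : int => N) -> pullup_carrier N) by apply: linear_unshift.
  have lT' : linear (T : pullup_carrier N -> direct_sum (fun _ : int => N)).
    by apply: (linear_inverse lT); apply: unshiftK.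
  have [h [lh [h' hK h'K]]] := direct_sum_reindex N int_of_natK nat_of_intK.
  have [f ef] := linear_bundle (linear_comp lh lT').
  exists f; rewrite ef; exists (T \o h') => d /=; first by rewrite hK; apply: unshiftK.
  by rewrite [T (T _)]unshiftK// h'K.
- move=> [f [f' fK f'K]]; apply: W.
  have lf : linear f by exact: (@linearP _ _ _ _ f).
  pose inj (x : N) : countable_copower N := @dsum_inj R nat (fun=> N) 0%N x.
  have linj : linear inj by apply: linear_dsum_inj.
  pose psi (v : pullup_carrier N) : N := (f v : dsum _) 0%N.
  apply: (@small_retracts_of_split R N (f' \o inj) psi) => //.
  + exact: linear_comp (linear_inverse lf fK f'K) linj.
  + by move=> a x y; rewrite /psi lf.
  + move=> x; rewrite /psi /= f'K.
    by rewrite /inj /= /dsum_inj_val; case: pselect => // e; rewrite (Prop_irrelevance e erefl).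
Qed.
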